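(* Let $\Pi$ be a Pasch space in which all closed line segments are connected. If the boundary at infinity $\partial(\Pi,A)$, with its natural relation of betweenness, is a circle for some $A\in\Pi$, then $\Pi$ is a plane.
   Context: A betweenness relation on a set $\Pi$ is a ternary relation ''$C$ is between $A$ and $B$'' such that, writing $s[A,B]$ for the set of all points between $A$ and $B$: (a) each point is between itself and any point of $\Pi$; (b) if $A$ is between $B$ and $C$, then $A$ is between $C$ and $B$; (c) if $C\in s[A,B]$, then $s[A,B]=s[A,C]\cup s[C,B]$ and $s[A,C]\cap s[C,B]=s[C,C]=\{C\}$. A closed line segment is a set of the form $s[A,B]$; its interior is $s(A,B)=s[A,B]\setminus\{A,B\}$. A subset $S$ is convex if $s[A,B]\subset S$ for all $A,B\in S$. A closed line segment is connected if, whenever it is expressed as a union of two disjoint non-empty convex subsets, precisely one of them is a closed line segment. A line is a set $l$ with a betweenness relation, consisting of at least two points, such that for every $A\in l$ the complement $l\setminus\{A\}$ is the union of two disjoint non-empty convex sets $c_1,c_2$ with $A\in s[B,C]$ whenever $B\in c_1$, $C\in c_2$. A line in $\Pi$ is a convex subset that is a line with the inherited betweenness. A circle is a set $c$ with a betweenness relation such that: $c$ contains at least three points; each $A\in c$ has an antipodal point $a(A)$ such that $s[A,a(A)]$ contains exactly two points; $s[A,B]$ is connected if $A$ is not antipodal to $B$; for each $A\in c$ the complement $c\setminus\{A,a(A)\}$ is the union of two disjoint non-empty convex sets that are lines with the inherited betweenness. A ray emanating from $A$ is a convex set $r$ such that: $A\in r$ but $A$ is not between any two other points of $r$; every three points of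 $r$ are contained in a closed line segment which is a subset of $r$; $r$ is not equal to any closed line segment. It is maximal if it is not a proper subset of another ray emanating from $A$, and connected if the closed line segments contained in it are connected. A space with maximal rays is a set with betweenness such that (1) if $s[A,B]$ and $s[A,C]$ have a common interior point, then one of them is contained in the other; (2) if $A\neq B$ and $s[A,B]$ is connected, then there is a connected $s[C,D]$ with $s[A,B]\subset s(C,D)$. If all closed line segments are connected, every $s[A,B]$ with $A\neq B$ is contained in a largest line in $\Pi$, denoted $l(A,B)$. A plane is a space $\Pi$ with maximal rays such that: $\Pi$ contains at least two points; for each pair of different points $A,B$ the segment $s[A,B]$ is connected and $\Pi\setminus l(A,B)$ is the union of two disjoint non-empty convex sets $h_1,h_2$ such that $s[C,D]$ intersects $l(A,B)$ at exactly one point whenever $C\in h_1$ and $D\in h_2$. Two maximal rays $r_1,r_2$ emanating from the same point $A$ are antipodal if there are $B\in r_1$, $C\in r_2$ with $A\in s(B,C)$. The boundary at infinity $\partial(\Pi,A)$ is the set of connected maximal rays emanating from $A$. A Pasch space is a space $\Pi$ with maximal rays satisfying the Pasch Condition: for every $A\in\Pi$ and every subset $\{r_1,r_2,r_3\}$ of $\partial(\Pi,A)$ disjoint from the set of its antipodal rays, and all points $B,C\in r_1\setminus\{A\}$ and $D\in r_3\setminus\{A\}$, if $r_2$ intersects $s[B,D]$ then $r_2$ intersects $s[C,D]$. The natural betweenness on $\partial(\Pi,A)$: if $r_1,r_2$ are antipodal or equal, $s[r_1,r_2]=\{r_1,r_2\}$; otherwise $r_3\in s[r_1,r_2]$ iff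 for every $B\in r_1$ and $C\in r_2$ the ray $r_3$ intersects $s[B,C]$. *)

(* Defs.v *)
From mathcomp Require Import all_boot.
From mathcomp Require Import boolp classical_sets functions.

Set Implicit Arguments.
Unset Strict Implicit.
Unset Printing Implicit Defensive.

Local Open Scope classical_set_scope.

(* A ternary relation on T is encoded by its segment map s : T -> T -> set T:
   s A B C means that C is between A and B, so that s A B is s[A,B].
   A subset is regarded as a set in its own right through the coercion
   set_type; the predicates below therefore always speak of a whole type. *)

Definition is_betweenness (T : Type) (s : T -> T -> set T) : Prop :=
  [/\ forall A B, s A B A,
      forall A B C, s B C A -> s C B A
    & forall A B C, s A B C ->
        [/\ s A B = s A C `|` s C B,
            s A C `&` s C B = s C C
          & s C C = [set C]]].

Definition inherited (T : Type) (s : T -> T -> set T) (S : set T) :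
    S -> S -> set S :=
  fun A B => [set C : S | s (set_val A) (set_val B) (set_val C)].

Definition closed_segment (T : Type) (s : T -> T -> set T) (S : set T) : Prop :=
  exists A B, S = s A B.

Definition seg_interior (T : Type) (s : T -> T -> set T) (A B : T) : set T :=
  s A B `\` [set A; B].

Definition convex (T : Type) (s : T -> T -> set T) (S : set T) : Prop :=
  forall A B, S A -> S B -> s A B `<=` S.

Definition convex_split (T : Type) (s : T -> T -> set T)
    (S S1 S2 : set T) : Prop :=
  [/\ S = S1 `|` S2, S1 `&` S2 = set0,
      S1 !=set0 /\ S2 !=set0 & convex s S1 /\ convex s S2].

Definition connected_segment (T : Type) (s : T -> T -> set T)
    (S : set T) : Prop :=
  closed_segment s S /\
  forall S1 S2, convex_split s S S1 S2 ->
    (closed_segment s S1 /\ ~ closed_segment s S2) \/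
    (~ closed_segment s S1 /\ closed_segment s S2).

Definition is_line (T : Type) (s : T -> T -> set T) : Prop :=
  [/\ is_betweenness s,
      exists A B : T, A <> B
    & forall A, exists c1 c2,
        convex_split s (~` [set A]) c1 c2 /\
        forall B C, c1 B -> c2 C -> s B C A].

Definition line_in (T : Type) (s : T -> T -> set T) (l : set T) : Prop :=
  convex s l /\ is_line (@inherited T s l).

(* The antipodal map a is uniquely determined: a two-point segment is never
   connected. *)
Definition is_circle (T : Type) (s : T -> T -> set T) : Prop :=
  [/\ is_betweenness s,
      exists A B C : T, [/\ A <> B, A <> C & B <> C]
    & exists a : T -> T,
        [/\ forall A, exists P Q, P <> Q /\ s A (a A) = [set P; Q],
            forall A B, B <> a A -> connected_segment s (s A B)
          & forall A, exists c1 c2,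
              [/\ convex_split s (~` [set A; a A]) c1 c2,
                  is_line (@inherited T s c1)
                & is_line (@inherited T s c2)]]].

Definition is_ray (T : Type) (s : T -> T -> set T) (A : T) (r : set T) : Prop :=
  [/\ convex s r,
      r A /\ (forall B C, r B -> r C -> B <> A -> C <> A -> ~ s B C A),
      forall B C D, r B -> r C -> r D ->
        exists P Q, [/\ s P Q `<=` r, s P Q B, s P Q C & s P Q D]
    & ~ closed_segment s r].

Definition maximal_ray (T : Type) (s : T -> T -> set T) (A : T)
    (r : set T) : Prop :=
  is_ray s A r /\ forall r', is_ray s A r' -> ~ r `<` r'.

Definition connected_ray (T : Type) (s : T -> T -> set T) (r : set T) : Prop :=
  forall B C, s B C `<=` r -> connected_segment s (s B C).

Definition maximal_rays_space (T : Type) (s : T -> T -> set T) : Prop :=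
  [/\ is_betweenness s,
      forall A B C, seg_interior s A B `&` seg_interior s A C !=set0 ->
        s A B `<=` s A C \/ s A C `<=` s A B
    & forall A B, A <> B -> connected_segment s (s A B) ->
        exists C D, connected_segment s (s C D) /\
                    s A B `<=` seg_interior s C D].

(* l = l(A,B) *)
Definition largest_line (T : Type) (s : T -> T -> set T) (A B : T)
    (l : set T) : Prop :=
  [/\ line_in s l, s A B `<=` l
    & forall l', line_in s l' -> s A B `<=` l' -> l' `<=` l].

Definition is_plane (T : Type) (s : T -> T -> set T) : Prop :=
  [/\ maximal_rays_space s,
      exists A B : T, A <> B
    & forall A B, A <> B ->
        connected_segment s (s A B) /\
        exists l, largest_line s A B l /\
          exists h1 h2,
            convex_split s (~` l) h1 h2 /\
            forall C D, h1 C -> h2 D -> exists P, s C D `&` l = [set P]].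

Definition antipodal (T : Type) (s : T -> T -> set T) (A : T)
    (r1 r2 : set T) : Prop :=
  [/\ maximal_ray s A r1, maximal_ray s A r2
    & exists B C, [/\ r1 B, r2 C & seg_interior s B C A]].

Definition boundary (T : Type) (s : T -> T -> set T) (A : T) : set (set T) :=
  [set r | maximal_ray s A r /\ connected_ray s r].

Definition pasch_space (T : Type) (s : T -> T -> set T) : Prop :=
  maximal_rays_space s /\
  forall A r1 r2 r3,
    [set r1; r2; r3] `<=` boundary s A ->
    [set r1; r2; r3] `&`
      [set r | exists r', [set r1; r2; r3] r' /\ antipodal s A r' r] = set0 ->
    forall B C D, (r1 `\ A) B -> (r1 `\ A) C -> (r3 `\ A) D ->
      r2 `&` s B D !=set0 -> r2 `&` s C D !=set0.

Definition boundary_betweenness (T : Type) (s : T -> T -> set T) (A : T) :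
    boundary s A -> boundary s A -> set (boundary s A) :=
  fun r1 r2 =>
    if `[< antipodal s A (set_val r1) (set_val r2) \/ r1 = r2 >]
    then [set r1; r2]
    else [set r3 | forall B C, set_val r1 B -> set_val r2 C ->
                     set_val r3 `&` s B C !=set0].

(* Main.v *)
(* Fix A such that the boundary at A is a circle; it consists of the rays from A.
   A circle has two halves on either side of an antipodal pair, and an arc from
   one half to the other passes through the pair.  By the Pasch condition, the
   points of a segment between rays r and w from A lie exactly on the rays of
   the arc s[r, w] as soon as r and w are not antipodal: a point on the ray
   antipodal to r would give two arcs from w, to r and to its antipode, with a
   common interior point.  So the lines through A separate the space, and
   continuing a segment locally keeps it straight if the line passes through A.
   This order of the rays at A, together with the Pasch condition at the other
   points, excludes local lines that fail to be lines; and a line l that avoids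
   A separates the points X for which s[A, X] misses l from those for which it
   meets l. *)

Require Import Defs.
From mathcomp Require Import all_boot.
From mathcomp Require Import boolp classical_sets functions.

Set Implicit Arguments.
Unset Strict Implicit.
Unset Printing Implicit Defensive.

Local Open Scope classical_set_scope.

(** * Betweenness and rays *)

(** The obstacle is that the axioms control segments only from a common endpoint. Continuing s[D, M]
    beyond M gives a ray at M that is unique, but M need not be between D and the later points of
    that ray. Hence the two notions [opposite] (local) and [through] (global), and a ray together
    with its continuation is not known to be a line until [through] holds for all pairs.
    Connectedness enters as a completeness axiom: of the two convex pieces of a cut segment
    precisely one is closed, so a failure of [through] has a first point. Lines through A come
    before all others for a further reason. The Pasch condition speaks only of pairwise
    non-antipodal rays, and at points other than A this has to be checked each time; the sides of
    lines through A are the means to do so. *)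

Section Betweenness.
Context (T : Type) (s : T -> T -> set T) (btw : is_betweenness s).

Lemma between_l A B : s A B A.
Proof. by case: btw => h _ _; exact: h. Qed.

Lemma between_sym A B C : s A B C -> s B A C.
Proof. by case: btw => _ h _; exact: h. Qed.

Lemma between_r A B : s A B B.
Proof. exact/between_sym/between_l. Qed.

Lemma between_id A B : s A A B -> B = A.
Proof.
by case: btw => _ _ h; have [_ _ ->] := h A A A (between_l A A).
Qed.

Lemma between_cases A B C D : s A B C -> s A B D -> s A C D \/ s C B D.
Proof.
by case: btw => _ _ h hC; have [-> _ _] := h A B C hC.
Qed.

Lemma between_chain A B C D : s A B C -> s A C D -> s A B D.
Proof.
by case: btw => _ _ h hC hD; have [-> _ _] := h A B C hC; left.
Qed.

Lemma between_chain_r A B C D : s A B C -> s C B D -> s A B D.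
Proof.
by case: btw => _ _ h hC hD; have [-> _ _] := h A B C hC; right.
Qed.

Lemma between_meet A B C D : s A B C -> s A C D -> s C B D -> D = C.
Proof.
case: btw => _ _ h hC hD hD'; have [_ e1 e2] := h A B C hC.
by have : (s A C `&` s C B) D by []; rewrite e1 e2.
Qed.

Lemma between_antisym A B C : s A B C -> s A C B -> B = C.
Proof. by move=> h1 h2; apply: (between_meet h1 h2); exact: between_r. Qed.

Lemma between_inner A B C D : s A B C -> s A C D -> s D B C.
Proof.
move=> hC hD; have [h|//] := between_cases (between_chain hC hD) hC.
by rewrite (between_antisym hD h); exact: between_l.
Qed.

Lemma between_inner_r A B C D : s A B C -> s C B D -> s A D C.
Proof.
move=> hC hD; apply: between_sym; apply: between_inner (between_sym hD).
exact: between_sym.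
Qed.

Lemma inherited_betweenness (S : set T) : is_betweenness (@inherited T s S).
Proof.
case: btw => _ _ h; split=> [x y|x y z|x y z hz].
- exact: between_l.
- exact: between_sym.
have [e1 e2 e3] := h _ _ _ hz.
have pw (U V : set T) w : U = V -> U w = V w by move=> ->.
split; apply/seteqP; split=> w.
- by move=> hw; have := pw _ _ (set_val w) e1; rewrite /inherited /= => <-.
- by move=> hw; have := pw _ _ (set_val w) e1; rewrite /inherited /= => ->.
- by move=> hw; have := pw _ _ (set_val w) e2; rewrite /inherited /= => <-.
- by move=> hw; have := pw _ _ (set_val w) e2; rewrite /inherited /= => ->.
- by move=> /between_id; exact: val_inj.
- by move=> ->; exact: between_l.
Qed.

(* Junk value: ray A A is everything. *)
Definition ray A B : set T := [set X | s A B X \/ s A X B].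

Definition line A B : set T := [set X | ray A B X \/ s B X A].

(* O need not lie between P and Q themselves; see [through]. *)
Definition opposite O P Q :=
  exists B C, [/\ ray O P B, ray O Q C, B <> O, C <> O & s B C O].

Lemma ray_l A B : ray A B A.
Proof. by left; exact: between_l. Qed.

Lemma ray_r A B : ray A B B.
Proof. by left; exact: between_r. Qed.

Lemma ray_sym A B C : ray A B C -> ray A C B.
Proof. by case=> h; [right|left]. Qed.

Lemma between_convex A B C D E : s A B C -> s A B D -> s C D E -> s A B E.
Proof.
move=> hC hD hE; have [h|h] := between_cases hC hD.
  apply: (between_chain hC); apply: between_chain_r h _; exact: between_sym.
by apply: (between_chain_r hC); apply: between_chain h _.
Qed.

Lemma ray_sub A B C D : ray A B C -> s A C D -> ray A B D.
Proof.
case=> h hD; first by left; exact: between_chain hD.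
by have [] := between_cases h hD => h'; [left|right]; last exact: between_inner_r h h'.
Qed.

Lemma line_ray A B C : ray A B C -> line A B C.
Proof. by left. Qed.

Lemma line_l A B : line A B A.
Proof. by left; exact: ray_l. Qed.

Lemma line_r A B : line A B B.
Proof. by left; exact: ray_r. Qed.

Lemma lineC A B C : line A B C -> line B A C.
Proof.
case=> [[]|] h; first by left; left; exact: between_sym.
- by right.
- by left; right.
Qed.

Lemma line_swap A B C : line A B C -> line A C B.
Proof.
case=> [[]|] h; first by left; right.
- by left; left.
- by right; exact: between_sym.
Qed.

Lemma lineP A B C : line A B C -> [\/ s A B C, s A C B | s B C A].
Proof. by case=> [[]|] h; constructor. Qed.

Lemma opposite_sym O P Q : opposite O P Q -> opposite O Q P.
Proof.
by case=> B [C [h1 h2 h3 h4 h5]]; exists C, B; split=> //; exact: between_sym.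
Qed.

Lemma opposite_between O P Q : P <> O -> Q <> O -> s P Q O -> opposite O P Q.
Proof. by move=> h1 h2 h3; exists P, Q; split=> //; exact: ray_r. Qed.

Lemma line_opposite A B C : B <> A -> C <> A -> line A B C ->
  ray A B C \/ opposite A B C.
Proof. by move=> nB nC [h|h]; [left|right; exact: opposite_between]. Qed.

End Betweenness.

(** * Spaces with maximal rays in which all segments are connected *)

Section Space.
Context (T : Type) (s : T -> T -> set T) (sp : maximal_rays_space s).
Hypothesis conn : forall A B : T, connected_segment s (s A B).

Let btw : is_betweenness s. Proof. by case: sp. Qed.
Local Notation bl := (between_l btw).
Local Notation br := (between_r btw).
Local Notation bsym := (between_sym btw).
Local Notation ray := (ray s).
Local Notation line := (line s).
Local Notation opposite := (opposite s).

(** A two-point segment splits into two singletons, both of them closed segments, whereas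
    connectedness allows only one. *)
Lemma between_dense A B : A <> B -> exists C, [/\ s A B C, C <> A & C <> B].
Proof.
move=> nAB; apply: contrapT => h.
have e : s A B = [set A] `|` [set B].
  apply/seteqP; split=> [X hX|X [->|->]]; [|exact: bl|exact: br].
  by apply: contrapT => n; apply: h; exists X; split=> // e; apply: n; [left|right].
have s1 X : s X X = [set X].
  by apply/seteqP; split=> [Y /(between_id btw)|Y ->] //; exact: bl.
have c1 X : closed_segment s [set X] by exists X, X; rewrite s1.
have [_ /(_ [set A] [set B])[]] := conn A B; last by case=> /(_ (c1 A)).
  split=> //; [|by split; [exists A|exists B]|].
    by apply/seteqP; split=> // X [->] /nAB.
  by split=> X Y -> ->; rewrite s1.
by case=> _ /(_ (c1 B)).
Qed.

Lemma between_extend A B : A <> B -> exists C, s A C B /\ C <> B.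
Proof.
case: sp => _ _ ext nAB; have [C [D [_ sub]]] := ext A B nAB (conn A B).
have [hA /not_orP[nAC nAD]] := sub A (bl A B).
have [hB /not_orP[nBC nBD]] := sub B (br A B).
have [h|h] := between_cases btw hB hA; last first.
  exists C; split; last exact/nesym.
  exact: between_inner (bsym hB) (bsym h).
by exists D; split; [exact: between_inner h|exact/nesym].
Qed.

Lemma between_nonbranching A B C X : X <> A -> s A B X -> s A C X -> ray A B C.
Proof.
case: sp => _ nb _ nXA hB hC.
have [<-|nXB] := EM (X = B); first by right.
have [e|nXC] := EM (X = C); first by left; rewrite -e.
have [] := nb A B C.
- by exists X; split; split=> //; case.
- by move/(_ _ (br A B)); right.
- by move/(_ _ (br A C)); left.
Qed.

Lemma ray_total A B C D : B <> A -> ray A B C -> ray A B D -> ray A C D.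
Proof.
move=> nB [hC|hC] [hD|hD].
- by have [] := between_cases btw hC hD => h; [left|right; exact: between_inner_r h].
- by right; exact: between_chain hC.
- by left; exact: between_chain hD.
- exact: between_nonbranching hC hD.
Qed.

Lemma ray_trans A B C D : C <> A -> ray A B C -> ray A C D -> ray A B D.
Proof. by move=> nC h; apply: ray_total nC _; exact: ray_sym. Qed.

Lemma ray_eq A B C : B <> A -> C <> A -> ray A B C -> ray A B = ray A C.
Proof.
move=> nB nC h; apply/seteqP; split=> D; first exact: ray_total h.
exact: ray_trans h.
Qed.

Lemma ray_convex A B C D E : B <> A -> ray A B C -> ray A B D -> s C D E ->
  ray A B E.
Proof.
move=> nB hC hD hE; have [h|h] := ray_total nB hC hD.
  by apply: (ray_sub btw hC); apply: (between_chain_r btw h); exact: bsym.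
by apply: (ray_sub btw hD); exact: between_chain_r h hE.
Qed.

Lemma opposite_ray O P P' Q Q' : P <> O -> Q <> O -> P' <> O -> Q' <> O ->
  ray O P P' -> ray O Q Q' -> opposite O P Q -> opposite O P' Q'.
Proof.
move=> nP nQ nP' nQ' hP hQ [B [C [hB hC nB nC hO]]].
by exists B, C; split=> //; [exact: ray_total hP hB|exact: ray_total hQ hC].
Qed.

(* Segments from a common endpoint do not branch, so neither do continuations
   of a segment beyond O. *)
Lemma opposite_unique O P Q R : P <> O -> Q <> O -> R <> O ->
  opposite O P Q -> opposite O P R -> ray O Q R.
Proof.
have key B B' C C' : B <> O -> C <> O -> s B C O -> s B' C' O -> s O B' B ->
    ray O C C'.
  move=> nB nC h h' hB; have h2 : s B C' O.
    exact: between_inner h' (bsym hB).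
  have [h3|h3] := between_nonbranching (nesym nB) h h2.
    by left; exact: between_inner h3 h2.
  by right; exact: between_inner h3 h.
move=> nP nQ nR [B [C [hB hC nB nC h]]] [B' [C' [hB' hC' nB' nC' h']]].
suff hh : ray O C C'.
  by apply: (ray_trans nC hC); apply: (ray_trans nC' hh); exact: ray_sym.
have [hBB|hBB] := ray_total nP hB hB'.
  by apply: ray_sym; exact: key h' h hBB.
exact: key h h' hBB.
Qed.

Lemma opposite_irrefl O P : P <> O -> ~ opposite O P P.
Proof.
move=> nP [B [C [hB hC nB nC h]]].
have [h'|h'] := ray_total nP hB hC.
  by apply: nC; exact: (between_antisym btw h (bsym h')).
by apply: nB; exact: (between_antisym btw (bsym h) (bsym h')).
Qed.

Lemma closed_segment_from U V S : S `<=` s U V -> S U -> closed_segment s S ->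
  exists E, S = s U E.
Proof.
move=> sub hU [P [Q e]].
have hP : s U V P by apply: sub; rewrite e; exact: bl.
have hQ : s U V Q by apply: sub; rewrite e; exact: br.
have hU' : s P Q U by rewrite -e.
have [h|h] := between_cases btw hP hQ.
  exists P; rewrite e (between_antisym btw hU' (bsym h)).
  by apply/seteqP; split=> X; exact: bsym.
exists Q; have h' := between_inner_r btw hP h.
by rewrite e (between_antisym btw (bsym h') (bsym hU')).
Qed.

(** Dedekind completeness: a set G closed towards U cuts s[U, V] into two convex pieces. One of
    these is a closed segment, and its endpoint other than U or V is the cut E. *)
Lemma segment_cut U V (G : set T) :
    (forall X Y, s U V Y -> G Y -> s U Y X -> G X) -> G U -> ~ G V ->
  exists2 E, s U V E &
    (G E /\ forall X, s E V X -> X <> E -> ~ G X) \/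
    (~ G E /\ forall X, s U E X -> X <> E -> G X).
Proof.
move=> down GU GV.
pose S1 := s U V `&` G; pose S2 := s U V `\` G.
have sp12 : convex_split s (s U V) S1 S2.
  split.
  - by rewrite /S1 /S2 setUIDK.
  - by apply/seteqP; split=> // X [[_ h] [_ /(_ h)]].
  - by split; [exists U; split=> //; exact: bl|exists V; split=> //; exact: br].
  split=> A B [hA gA] [hB gB] X hX.
    split; first exact: between_convex hX.
    have [h|h] := between_cases btw hA hB.
      by apply: (down _ A) => //; apply: (between_chain_r btw h); exact: bsym.
    apply: (down _ B) => //.
    exact: between_chain_r (between_inner_r btw hA h) hX.
  have hUX : s U V X by exact: between_convex hX.
  split=> // gX.
  have [h|h] := between_cases btw hA hB.
    by apply: gB; apply: down gX _ => //; apply: (between_inner_r btw h); exact: bsym.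
  apply: gA; apply: down gX _ => //.
  exact: between_inner_r (between_inner_r btw hA h) hX.
have [_ /(_ _ _ sp12)[[c1 _]|[_ c2]]] := conn U V.
  have [E eE] := closed_segment_from (@subIsetl _ _ _) (conj (bl U V) GU) c1.
  have [hE gE] : S1 E by rewrite [S1]eE; exact: br.
  exists E => //; left; split=> // X hX nX gX; apply: nX.
  have : S1 X by split=> //; exact: between_chain_r hE hX.
  rewrite [S1]eE => hX'; exact: between_meet hE hX' hX.
have [|E eE] := @closed_segment_from V U S2 _ (conj (br U V) GV) c2.
  by move=> X [h _]; exact: bsym.
have [hE gE] : S2 E by rewrite [S2]eE; exact: br.
exists E => //; right; split=> // X hX nX; apply: contrapT => gX; apply: nX.
have : S2 X by split=> //; exact: between_chain hE hX.
by rewrite [S2]eE => /bsym hX'; exact: between_meet hE hX hX'.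
Qed.

Lemma opposite_extend O P : P <> O ->
  exists Q, [/\ Q <> O, s P Q O & opposite O P Q].
Proof.
move=> nP; have [Q [hQ nQ]] := between_extend nP.
by exists Q; split=> //; exact: opposite_between.
Qed.

(* If the continuation of s[D, M] beyond M does not run through s[D, N], then
   there is a first point E of it for which M is not between D and E: a last
   point of the other kind could be passed by extending a segment. *)
Lemma opposite_break D M N : D <> M -> N <> M -> opposite M D N -> ~ s D N M ->
  exists E, [/\ ray M N E, E <> M, ~ s D E M &
                forall X, s M E X -> X <> E -> s D X M].
Proof.
move=> nD nN opp bad.
have [N0 [nN0 hN0 opp0]] := opposite_extend nD.
have rN : ray M N N0 by exact: opposite_unique opp opp0.
have {}rN : s M N N0.
  by case: rN => h //; case: bad; exact: between_inner_r hN0 h.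
have down X Y : s M N Y -> s D Y M -> s M Y X -> s D X M.
  by move=> _; exact: between_inner_r.
have [E hE [[gE bE]|[bE gE]]] := segment_cut down (br D M) bad; last first.
  exists E; split=> //; first by left.
  by move=> e; apply: bE; rewrite e; exact: br.
have nE : E <> M.
  by move=> e; apply: (bE N0) => //; rewrite e.
have nDE : D <> E by move=> e; move: gE; rewrite e => /(between_id btw) /esym.
have [E' [hE' nE']] := between_extend nDE.
have hM' : s D E' M := between_chain btw hE' gE.
have hME' : s M E' E by exact: between_inner hE' gE.
have [h|h] : ray M N E' by apply: (ray_trans nE) (or_intror hME'); left.
  by case: (bE E' (between_inner btw h hME') nE' hM').
by case: bad; exact: between_inner_r hM' h.
Qed.

(** Straightness beyond M, as seen from D: the local continuation given by [opposite] is a global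
    one. *)
Definition through D M := forall N, N <> M -> opposite M D N -> s D N M.

(** Seen from U, each hypothesis is either a common ray or an opposition. Two oppositions compose to
    a common ray by [opposite_unique]; a single one remains an opposition, and [through V U] turns
    it into betweenness. *)
Lemma line_exchange U V X W : V <> U -> X <> U -> W <> U -> through V U ->
  line U V X -> line U X W -> line U V W.
Proof.
move=> nV nX nW thr /(line_opposite btw nV nX) hX /(line_opposite btw nX nW).
case: hX => hX [hW|hW].
- by left; exact: ray_trans hX hW.
- right; apply: thr => //; apply: (opposite_ray nX nW nV nW) hW => //.
    exact: ray_sym.
  exact: ray_r.
- right; apply: thr => //; apply: (opposite_ray nV nX nV nW) hX => //.
  exact: ray_r.
- by left; apply: (opposite_unique nX nV nW) hW; exact: opposite_sym.
Qed.

(** * The rays that form the boundary at infinity *)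

Section Boundary.
Variable A : T.

Lemma ray_is_ray B : B <> A -> is_ray s A (ray A B).
Proof.
move=> nB; split.
- by move=> C D hC hD X; exact: ray_convex hC hD.
- split; first exact: ray_l.
  move=> C D hC hD nC nD h; apply: (@opposite_irrefl A B) => //.
  by exists C, D.
- move=> C D E hC hD hE.
  have join X Y : ray A B X -> ray A B Y ->
      exists Z, [/\ ray A B Z, s A Z X & s A Z Y].
    move=> hX hY; have [h|h] := ray_total nB hX hY; [exists X|exists Y];
      by split=> //; exact: br.
  have [F [hF FC FD]] := join C D hC hD; have [G [hG GF GE]] := join F E hF hE.
  exists A, G; split; first by move=> X; exact: ray_sub.
  - exact: between_chain GF FC.
  - exact: between_chain GF FD.
  - exact: GE.
- case=> P [Q e].
  have hA : s P Q A by rewrite -e; exact: ray_l.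
  (* A segment starting at A would end at some R, but the ray goes on beyond R. *)
  have key R : ray A B <> s A R.
    move=> eR; have nR : A <> R.
      move=> nR; apply: nB; apply: (between_id btw); rewrite {2}nR -eR.
      exact: ray_r.
    have [R' [hR' nR']] := between_extend nR.
    have hBR : ray A B R by rewrite eR; exact: br.
    have := ray_trans (nesym nR) hBR (or_intror hR').
    rewrite eR => h; apply: nR'; exact: between_antisym hR' h.
  have [eP|nP] := EM (P = A); first by apply: (key Q); rewrite e eP.
  have [eQ|nQ] := EM (Q = A).
    by apply: (key P); rewrite e eQ; apply/seteqP; split=> X; exact: bsym.
  apply: (@opposite_irrefl A B) => //; exists P, Q.
  by split=> //; rewrite e; [exact: bl|exact: br].
Qed.

(** A, B and X lie on a segment inside r, and A, not being between two other points of r, must be an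
    endpoint of it. This makes [ray A B] maximal and every boundary element of that form. *)
Lemma is_ray_sub r B : is_ray s A r -> r B -> B <> A -> r `<=` ray A B.
Proof.
move=> [cv [rA emid] three _] rB nB X rX.
have [P [Q [sub hA hB hX]]] := three A B X rA rB rX.
have rP : r P by apply: sub; exact: bl.
have rQ : r Q by apply: sub; exact: br.
have key R : s A R B -> s A R X -> ray A B X.
  move=> h1 h2; have [h|h] := between_cases btw h1 h2; first by left.
  by right; exact: between_inner_r h1 h.
have [eP|nP] := EM (P = A); first by move: hB hX; rewrite eP; exact: key.
have [eQ|nQ] := EM (Q = A); last by case: (emid P Q).
by move: hB hX; rewrite eQ => /bsym h1 /bsym h2; exact: key h1 h2.
Qed.

Lemma ray_boundary B : B <> A -> boundary s A (ray A B).
Proof.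
move=> nB; split; last by move=> C D _; exact: conn.
split=> [|r' hr' [sub nsub]]; first exact: ray_is_ray.
apply: nsub; apply: is_ray_sub => //; apply: sub; exact: ray_r.
Qed.

Lemma boundary_ray r : boundary s A r -> exists2 B, B <> A & r = ray A B.
Proof.
move=> [[hr mx] _].
have [B rB nB] : exists2 B, r B & B <> A.
  apply: contrapT => h; case: hr => _ [rA _] _; apply; exists A, A.
  apply/seteqP; split=> [X rX|X /(between_id btw) -> //].
  have [->|nX] := EM (X = A); first exact: bl.
  by case: h; exists X.
exists B => //; apply: contrapT => ne; apply: (mx _ (ray_is_ray nB)).
have sub : r `<=` ray A B by exact: is_ray_sub.
by split=> // sub'; apply: ne; apply/seteqP.
Qed.

Lemma antipodal_opposite P Q : P <> A -> Q <> A ->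
  antipodal s A (ray A P) (ray A Q) <-> opposite A P Q.
Proof.
move=> nP nQ; split=> [[_ _ [B [C [hB hC [h /not_orP[n1 n2]]]]]]|[B [C [hB hC nB nC h]]]].
  by exists B, C; split=> //; exact: nesym.
have [[m1 _] [m2 _]] := (ray_boundary nP, ray_boundary nQ).
by split=> //; exists B, C; split=> //; split=> // -[e|e]; [exact: nB|exact: nC].
Qed.

End Boundary.

Hypothesis pasch : pasch_space s.

(** The Pasch condition in terms of points. Disjointness from the antipodal rays amounts to three
    pairs of rays not being opposite, since no ray is opposite to itself. *)
Lemma pasch_ray O P P' Q R : P <> O -> P' <> O -> Q <> O -> R <> O ->
  ~ opposite O P Q -> ~ opposite O R P -> ~ opposite O R Q -> ray O P P' ->
  (exists2 X, ray O R X & s P Q X) -> exists2 X, ray O R X & s P' Q X.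
Proof.
move=> nP nP' nQ nR oPQ oRP oRQ hP [X hX hX'].
have oQP : ~ opposite O Q P by move/(opposite_sym btw).
have oPR : ~ opposite O P R by move/(opposite_sym btw).
have oQR : ~ opposite O Q R by move/(opposite_sym btw).
have sub : [set ray O P; ray O R; ray O Q] `<=` boundary s O.
  by move=> r [[]|] ->; exact: ray_boundary.
have dis : [set ray O P; ray O R; ray O Q] `&`
    [set r | exists r', [set ray O P; ray O R; ray O Q] r' /\
                        antipodal s O r' r] = set0.
  apply/seteqP; split=> // r [hr [r' [hr']]].
  have key U V : U <> O -> V <> O -> ~ opposite O U V ->
      ~ antipodal s O (ray O U) (ray O V).
    by move=> nU nV h /(antipodal_opposite nU nV).
  by case: hr' => [[]|] ->; case: hr => [[]|] ->; apply: key => //;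
    exact: opposite_irrefl.
have [||||Y [hY hY']] := pasch.2 O _ _ _ sub dis P P' Q; last by exists Y.
- by split=> //; exact: ray_r.
- by split.
- by split=> //; exact: ray_r.
- by exists X.
Qed.

End Space.

(** The separation axiom of a line without its two convex sets: being on the same side of p is
    witnessed by a common point z across p. *)
Lemma line_separates (T : Type) (s : T -> T -> set T) (m : set T) p x y :
  is_line (@inherited T s m) -> m p -> m x -> m y -> x <> p -> y <> p ->
  s x y p \/ exists z, [/\ m z, z <> p, s x z p & s y z p].
Proof.
move=> [hb _ sep] mp mx my nx ny.
pose P : m := SigSub (mem_set mp).
pose X : m := SigSub (mem_set mx).
pose Y : m := SigSub (mem_set my).
have [c1 [c2 [[e d [[z1 hz1] [z2 hz2]] _] h]]] := sep P.
have nX : (c1 `|` c2) X by rewrite -e => E; apply: nx; exact: (congr1 set_val E).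
have nY : (c1 `|` c2) Y by rewrite -e => E; apply: ny; exact: (congr1 set_val E).
have ne (z : m) : (c1 `|` c2) z -> set_val z <> p.
  by rewrite -e => nz E; apply: nz; exact: val_inj.
have h' B C : c2 B -> c1 C -> inherited s B C P.
  by move=> hB hC; case: hb => _ sym _; apply: sym; exact: h.
have key (d1 d2 : set m) z : d1 X -> d1 Y -> d2 z -> (c1 `|` c2) z ->
    (forall B C, d1 B -> d2 C -> inherited s B C P) ->
    exists z, [/\ m z, z <> p, s x z p & s y z p].
  move=> hX hY hz nz hs; exists (set_val z).
  by split; [exact: set_valP|exact: ne|exact: (hs X)|exact: (hs Y)].
case: nX nY => hX [] hY; [right|left|left|right].
- by apply: (key c1 c2 z2) => //; right.
- exact: (h X Y).
- exact: (h' X Y).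
- by apply: (key c2 c1 z1) => //; left.
Qed.

(** * Circles *)

Section Circle.
Context (c : Type) (t : c -> c -> set c) (a : c -> c).
Hypothesis btw : is_betweenness t.
Hypothesis two : forall A, exists P Q, P <> Q /\ t A (a A) = [set P; Q].
Hypothesis con : forall A B, B <> a A -> connected_segment t (t A B).
Hypothesis parts : forall A, exists c1 c2,
  [/\ convex_split t (~` [set A; a A]) c1 c2,
      is_line (@inherited c t c1) & is_line (@inherited c t c2)].

Local Notation bl := (between_l btw).
Local Notation br := (between_r btw).
Local Notation bsym := (between_sym btw).

Lemma antipode_neq r : a r <> r.
Proof.
move=> e; have [P [Q [nPQ]]] := two r; rewrite e => E.
have hP : t r r P by rewrite E; left.
have hQ : t r r Q by rewrite E; right.
by apply: nPQ; rewrite (between_id btw hP) (between_id btw hQ).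
Qed.

Lemma antipode_segment r x : t r (a r) x -> x = r \/ x = a r.
Proof.
have [P [Q [nPQ E]]] := two r.
have : [set P; Q] r by rewrite -E; exact: bl.
have : [set P; Q] (a r) by rewrite -E; exact: br.
have nr := @antipode_neq r.
by rewrite E => -[] e1 [] e2 [] e3; first [left; congruence|right; congruence].
Qed.

Lemma circle_connected_neq x y : y <> a x -> x <> y ->
  ~ forall z, t x y z -> z = x \/ z = y.
Proof.
move=> /con cn nxy h; have [_ /(_ [set x] [set y])[]] := cn.
- split.
  + apply/seteqP; split=> z; first exact: h.
    by case=> ->; [exact: bl|exact: br].
  + by apply/seteqP; split=> // z [->] /nxy.
  + by split; [exists x|exists y].
  + by split=> u v -> -> w /(between_id btw).
- by case=> _; apply; exists y, y; apply/seteqP; split=> [z ->|z /(between_id btw)] //; exact: bl.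
- by case; case; exists x, x; apply/seteqP; split=> [z ->|z /(between_id btw)] //; exact: bl.
Qed.

Lemma circle_dense x y : y <> a x -> x <> y ->
  exists z, [/\ t x y z, z <> x & z <> y].
Proof.
move=> h nxy; apply: contrapT => h'; apply: (circle_connected_neq h nxy).
move=> z hz; apply: contrapT => /not_orP[n1 n2]; apply: h'; by exists z.
Qed.

(** The segment from r to [a r] has two points, so it is disconnected, and only antipodal pairs have
    disconnected segments. *)
Lemma antipodeK r : a (a r) = r.
Proof.
apply: contrapT => h; apply: (@circle_connected_neq (a r) r (nesym h)).
  exact: antipode_neq.
by move=> z /bsym /antipode_segment []; auto.
Qed.

(** Nothing lies strictly between r and [a r], so an arc containing both falls apart into two
    disjoint closed segments, one ending at each of them. A connected arc cannot do so. *)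
Lemma no_antipodes_between x y r : t x y r -> t x y (a r) -> y = a x.
Proof.
suff key p q u v : t u v p -> t u q p -> t u v q -> q = a p -> v = a u.
  move=> h1 h2; have [h|h] := between_cases btw h2 h1.
    exact: (key r (a r) x y h1 h h2).
  apply: (key (a r) r x y) => //; last by rewrite antipodeK.
  exact: between_inner_r h2 h.
move=> h1 h2 h3 e; apply: contrapT => /con [_ /(_ (t u p) (t q v))] [].
- split.
  + apply/seteqP; split=> w.
      case/(between_cases btw h3); last by right.
      case/(between_cases btw h2); first by left.
      rewrite e => /antipode_segment[->|->]; [left; exact: br|right; rewrite -e; exact: bl].
    by case=> hw; [exact: between_chain hw|exact: between_chain_r hw].
  + apply/seteqP; split=> // w [w1 w2].
    have wq : w = q.
      exact: between_meet h3 (between_chain btw h2 w1) w2.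
    rewrite wq in w1.
    by have := between_antisym btw h2 w1; rewrite e => /antipode_neq.
  + by split; [exists u; exact: bl|exists q; exact: bl].
  + by split=> x' y' hx hy z hz; exact: between_convex hz.
- by case=> _; apply; exists q, v.
- by case; case; exists u, p.
Qed.

(** The line has a point z beyond x as seen from [a x]. The arc from [a x] to z then contains x and
    [a x], so z is the antipode of [a x], which is x. *)
Lemma part_no_antipodes (m : set c) x :
  is_line (@inherited c t m) -> m x -> m (a x) -> False.
Proof.
move=> lm mx max.
have nx := @antipode_neq x.
have [|[z [mz nz h _]]] := line_separates lm mx max max nx nx.
  by move/(between_id btw) => e; apply: nx.
by apply: nz; rewrite (no_antipodes_between h _) ?antipodeK //; exact: bl.
Qed.

Definition halves r (c1 c2 : set c) :=
  [/\ convex_split t (~` [set r; a r]) c1 c2,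
      is_line (@inherited c t c1) & is_line (@inherited c t c2)].

Lemma halves_sym r c1 c2 : halves r c1 c2 -> halves r c2 c1.
Proof.
move=> [[e d [n1 n2] [v1 v2]] l1 l2]; split=> //; split=> //.
- by rewrite e setUC.
- by rewrite setIC d.
Qed.

Section Halves.
Context (r : c) (c1 c2 : set c) (H : halves r c1 c2).

Lemma halves_cover x : x <> r -> x <> a r -> c1 x \/ c2 x.
Proof.
case: H => [[e _ _ _] _ _] n1 n2; suff : (c1 `|` c2) x by [].
by rewrite -e => -[].
Qed.

Lemma half_off x : c1 x -> x <> r /\ x <> a r.
Proof.
case: H => [[e _ _ _] _ _] hx; have : (c1 `|` c2) x by left.
by rewrite -e => h; split=> n; apply: h; [left|right].
Qed.

Lemma half_convex x y z : c1 x -> c1 y -> t x y z -> c1 z.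
Proof. by case: H => [[_ _ _ [h _]] _ _] hx hy; exact: h. Qed.

Lemma half_no_antipodes x : c1 x -> c1 (a x) -> False.
Proof. by case: H => _ l _; exact: part_no_antipodes. Qed.

Lemma halves_disjoint x : c1 x -> c2 x -> False.
Proof.
case: H => [[_ d _ _] _ _] h1 h2; have : (c1 `&` c2) x by [].
by rewrite d.
Qed.

End Halves.

Lemma half_antipode r c1 c2 x : halves r c1 c2 -> c1 x -> c2 (a x).
Proof.
move=> H hx; have [n1 n2] := half_off H hx.
have [||//|h] := halves_cover (halves_sym H) (x := a x).
- by move=> e; apply: n2; rewrite -e antipodeK.
- by move=> e; apply: n1; rewrite -(antipodeK x) e antipodeK.
by case: (half_no_antipodes H hx).
Qed.

(** Take w strictly between x and [a y], different from r and [a r]. The cut at w separates x from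
    [a y], so x and y share a half of it, together with p, one of r and [a r]. In that half, which
    is a line, p is between x and y: otherwise p would be between some z and each of x and y, while
    z shares a half of the cut at r with one of them, and that half is convex and omits p. *)
Lemma halves_cross r c1 c2 x y : halves r c1 c2 -> c1 x -> c2 y -> y <> a x ->
  t x y r \/ t x y (a r).
Proof.
move=> H hx hy nyax.
have [xr xar] := half_off H hx; have [yr yar] := half_off (halves_sym H) hy.
have nxay : x <> a y by move=> e; apply: nyax; rewrite e antipodeK.
have nxy : a y <> a x.
  move=> e; have exy : y = x by rewrite -(antipodeK y) e antipodeK.
  by apply: (halves_disjoint H hx); rewrite -exy.
have noanti z : t x (a y) z -> t x (a y) (a z) -> False.
  by move=> h1 h2; apply: nxy; exact: no_antipodes_between h1 h2.
have [w [hw wx way wr war]] : exists w,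
    [/\ t x (a y) w, w <> x, w <> a y, w <> r & w <> a r].
  (* If the first choice of w happens to be r or [a r], a point between x and it will do. *)
  have near p : p = r \/ p = a r -> t x (a y) p -> exists w,
      [/\ t x (a y) w, w <> x, w <> a y, w <> p & w <> a p].
    move=> ep hp.
    have [] := @circle_dense x p.
    - by case: ep => -> e; [apply: xar; rewrite e antipodeK|apply: xr; rewrite -(antipodeK r) e antipodeK].
    - by case: ep => ->.
    move=> w [hw wx wp]; have hw' := between_chain btw hp hw.
    exists w; split=> // e.
      by apply: wp; rewrite e; apply: (between_antisym btw hp); rewrite -e.
    by apply: (noanti p hp); rewrite -e.
  have [w [hw wx way]] := circle_dense nxy nxay.
  have [e|nr] := EM (w = r).
    by apply: near; [left|rewrite -e].
  have [e|nar] := EM (w = a r); last by exists w.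
  have [|w' [h1 h2 h3 h4 h5]] := near (a r) (or_intror erefl); first by rewrite -e.
  by exists w'; split=> //; rewrite antipodeK in h5.
have [d1 [d2 D]] : exists d1 d2, halves w d1 d2 by exact: parts.
have xaw : x <> a w.
  by move=> e; apply: (noanti w hw); rewrite -e; exact: bl.
wlog dx : d1 d2 D / d1 x.
  by move=> W; have [h|h] := halves_cover D (nesym wx) xaw; [exact: W D h|exact: W (halves_sym D) h].
have ayaw : a y <> a w.
  by move=> e; apply: (noanti w hw); rewrite -e; exact: br.
have day : d2 (a y).
  have [h|//] := halves_cover D (nesym way) ayaw.
  by have /(half_off D)[] := half_convex D dx h hw.
have dy : d1 y by rewrite -(antipodeK y); exact: half_antipode (halves_sym D) day.
have [p ep dp] : exists2 p, p = r \/ p = a r & d1 p.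
  have raw : r <> a w by move=> e; apply: war; rewrite e antipodeK.
  have [h|h] := halves_cover D (nesym wr) raw; first by exists r; auto.
  by exists (a r); auto; exact: half_antipode (halves_sym D) h.
have px : x <> p by case: ep => ->.
have py : y <> p by case: ep => ->.
have [h|[z [dz zp h1 h2]]] := line_separates (let: And3 _ l _ := D in l) dp dx dy px py.
  by case: ep h => ->; auto.
have zap : z <> a p by move=> e; apply: (half_no_antipodes D dp); rewrite -e.
exfalso; have [] := @halves_cover _ _ _ H z.
- by case: ep zp zap => -> //; rewrite antipodeK.
- by case: ep zp zap => -> //; rewrite antipodeK.
- move=> hz; have /(half_off H)[] := half_convex H hx hz h1.
  by case: ep => ->.
- move=> hz; have /(half_off (halves_sym H))[] := half_convex (halves_sym H) hy hz h2.
  by case: ep => ->.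
Qed.

(* Removing x and its antipode separates w from both q and a q, which would
   then be two antipodal points of the same half. *)
Lemma arcs_to_antipodes_disjoint w q x : w <> q -> w <> a q -> x <> q ->
  x <> a q -> x <> w -> t w q x -> t w (a q) x -> False.
Proof.
move=> wq waq xq xaq xw h1 h2.
have [d1 [d2 D]] : exists d1 d2, halves x d1 d2 by exact: parts.
have wax : w <> a x.
  move=> e; have : q = a w by apply: (no_antipodes_between h1); rewrite -e; exact: bl.
  by rewrite e antipodeK => /esym.
have qax : q <> a x by move=> e; apply: xaq; rewrite e antipodeK.
have aqax : a q <> a x by move=> e; apply: xq; rewrite -(antipodeK x) -e antipodeK.
wlog dw : d1 d2 D / d1 w.
  by move=> W; have [h|h] := halves_cover D (nesym xw) wax; [exact: W D h|exact: W (halves_sym D) h].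
have far v : v <> x -> v <> a x -> t w v x -> d2 v.
  move=> n1 n2 h; have [hv|//] := halves_cover D n1 n2.
  by have /(half_off D)[] := half_convex D dw hv h.
have k1 := far q (nesym xq) qax h1.
have k2 := far (a q) (nesym xaq) aqax h2.
exact: (half_no_antipodes (halves_sym D) k1).
Qed.

Lemma half_open r c1 c2 x u : halves r c1 c2 -> c1 x -> t r x u -> u <> r -> c1 u.
Proof.
move=> H hx hu nu; have [xr xar] := half_off H hx.
have uar : u <> a r.
  move=> e; have : x = a r; last by [].
  by apply: (@no_antipodes_between r x r); [exact: bl|rewrite -e].
have [//|hu'] := halves_cover H nu uar.
have nxau : x <> a u.
  move=> e; have : x = a r; last by [].
  by apply: (no_antipodes_between hu); rewrite -e; exact: br.
have [h|h] := halves_cross (halves_sym H) hu' hx nxau.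
  by case: nu; apply/esym; apply: (between_antisym btw (bsym hu)); exact: bsym.
have : x = a r; last by [].
apply: (@no_antipodes_between r x r); first exact: bl.
exact: between_chain_r hu h.
Qed.

(* If neither were between r and the other, both x and y would lie beyond each
   other on the way to a r. *)
Lemma half_total r c1 c2 x y : halves r c1 c2 -> c1 x -> c1 y -> x <> y ->
  t r x y \/ t r y x.
Proof.
move=> H hx hy nxy; apply: contrapT => /not_orP[nx ny].
have Har : halves (a r) c1 c2 by move: H; rewrite /halves antipodeK setUC.
have key u v : c1 u -> c1 v -> u <> v -> ~ t r u v -> ~ t r v u -> t v (a r) u.
  move=> hu hv nuv n1 n2.
  have [ur uar] := half_off H hu; have [vr var] := half_off H hv.
  have [d1 [d2 D]] : exists d1 d2, halves u d1 d2 by exact: parts.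
  have rau : r <> a u by move=> e; apply: uar; rewrite e antipodeK.
  wlog dr : d1 d2 D / d1 r.
    by move=> W; have [h|h] := halves_cover D (nesym ur) rau; [exact: W D h|exact: W (halves_sym D) h].
  have nvau : v <> a u by move=> e; apply: (half_no_antipodes H hu); rewrite -e.
  have dv : d1 v.
    have [//|dv] := halves_cover D (nesym nuv) nvau.
    have [//|h] := halves_cross D dr dv var.
    case: (half_no_antipodes H hu); apply: half_open H hv h _.
    by move=> e; apply: rau.
  have [||h] := halves_cross D dv (half_antipode D dr).
  - by move=> e; apply: vr; rewrite -(antipodeK v) -e antipodeK.
  - by [].
  case: (half_no_antipodes Har hu); apply: half_open Har hv (bsym h) _ => //.
  by move=> e; apply: ur; rewrite -(antipodeK u) e antipodeK.
have k1 := key x y hx hy nxy nx ny.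
have k2 := key y x hy hx (nesym nxy) ny nx.
by apply: nxy; exact: (between_antisym btw (bsym k2) (bsym k1)).
Qed.

End Circle.

(** * Directions at a point whose boundary is a circle *)

Section Centre.
Context (T : Type) (s : T -> T -> set T) (pasch : pasch_space s).
Hypothesis conn : forall A B : T, connected_segment s (s A B).
Context (A : T) (r0 : boundary s A) (a : boundary s A -> boundary s A).
Local Notation t := (@boundary_betweenness T s A).
Hypothesis tbtw : is_betweenness t.
Hypothesis two : forall r, exists P Q, P <> Q /\ t r (a r) = [set P; Q].
Hypothesis con : forall r q, q <> a r -> connected_segment t (t r q).
Hypothesis parts : forall r, exists c1 c2,
  [/\ convex_split t (~` [set r; a r]) c1 c2,
      is_line (@inherited _ t c1) & is_line (@inherited _ t c2)].

Let sp : maximal_rays_space s := pasch.1.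
Let btw : is_betweenness s. Proof. by case: sp. Qed.
Local Notation bl := (between_l btw).
Local Notation br := (between_r btw).
Local Notation bsym := (between_sym btw).
Local Notation tl := (between_l tbtw).
Local Notation tr := (between_r tbtw).
Local Notation tsym := (between_sym tbtw).
Local Notation ray := (ray s).
Local Notation line := (line s).
Local Notation opposite := (opposite s).

(** A total function for convenience; [dir A] is the junk value [r0]. *)
Definition dir B : boundary s A :=
  if pselect (B <> A) is left nB
  then SigSub (mem_set (ray_boundary sp conn nB)) else r0.

Lemma val_dir B : B <> A -> set_val (dir B) = ray A B.
Proof. by rewrite /dir; case: pselect. Qed.

Lemma boundary_inj (z w : boundary s A) : set_val z = set_val w -> z = w.
Proof. exact: val_inj. Qed.

Lemma dirP (z : boundary s A) : exists2 B, B <> A & z = dir B.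
Proof.
have [B nB e] : exists2 B, B <> A & set_val z = ray A B.
  exact: boundary_ray (set_valP z).
by exists B => //; apply: boundary_inj; rewrite e val_dir.
Qed.

Lemma dir_eq B C : B <> A -> C <> A -> dir B = dir C <-> ray A B C.
Proof.
move=> nB nC; split=> [e|h].
  by rewrite -val_dir // e val_dir //; exact: ray_r.
by apply: boundary_inj; rewrite !val_dir //; exact: ray_eq.
Qed.

Lemma antipodal_dir B C : B <> A -> C <> A ->
  antipodal s A (set_val (dir B)) (set_val (dir C)) <-> opposite A B C.
Proof. by move=> nB nC; rewrite !val_dir //; exact: antipodal_opposite. Qed.

(** Identifies the abstract antipodal map with opposition of rays. By definition of the natural
    betweenness an opposite pair has a segment without further points, which is possible only for
    antipodes. Conversely, extending s[B, A] beyond A yields an opposite ray, whose direction is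
    then the antipode. *)
Lemma dir_opposite B C : B <> A -> C <> A ->
  dir C = a (dir B) <-> opposite A B C.
Proof.
move=> nB nC.
have fwd X : X <> A -> opposite A B X -> dir X = a (dir B).
  move=> nX h; apply: contrapT => /(circle_connected_neq tbtw con); apply.
    move/dir_eq => /(_ nB nX) h'; apply: (opposite_irrefl sp nB).
    by apply: (opposite_ray sp nB nX nB nB _ _ h); [exact: ray_r|exact: ray_sym].
  move=> z; rewrite /boundary_betweenness asboolT //.
  by left; apply/antipodal_dir.
split=> [e|]; last exact: fwd.
have [Q [nQ _ h]] := opposite_extend sp conn nB.
move: (fwd Q nQ h); rewrite -e => /dir_eq => /(_ nQ nC) h'.
by apply: (opposite_ray sp nB nQ nB nC _ h' h); exact: ray_r.
Qed.

Lemma dir_between B C Z : B <> A -> C <> A -> Z <> A -> dir C <> a (dir B) ->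
  dir B <> dir C ->
  t (dir B) (dir C) (dir Z) <-> forall X Y, ray A B X -> ray A C Y ->
     exists2 W, ray A Z W & s X Y W.
Proof.
move=> nB nC nZ nopp ne; rewrite /boundary_betweenness asboolF.
  rewrite /= !val_dir //; split=> h X Y hX hY.
    by have [W [hW hW']] := h X Y hX hY; exists W.
  by have [W hW hW'] := h X Y hX hY; exists W.
by case=> // /antipodal_dir => /(_ nB nC) /dir_opposite => /(_ nB nC).
Qed.

Lemma not_between_centre B C : B <> A -> C <> A -> dir C <> a (dir B) ->
  ~ s B C A.
Proof.
move=> nB nC h h'; apply: h; apply/dir_opposite => //.
exact: opposite_between.
Qed.

Lemma dir_convex B C Z : B <> A -> C <> A -> Z <> A -> dir B = dir C ->
  s B C Z -> dir Z = dir B.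
Proof.
move=> nB nC nZ /dir_eq => /(_ nB nC) h hZ; apply/esym/dir_eq => //.
exact: (ray_convex sp nB (ray_r btw _ _) h hZ).
Qed.

(** The ray AZ has to meet s[X, Y] for all X and Y on the rays AB and AC. It meets s[B, C] at Z, and
    Pasch moves B to X and then C to Y. *)
Lemma dir_pasch B C Z : B <> A -> C <> A -> Z <> A -> s B C Z ->
  dir C <> a (dir B) -> dir Z <> a (dir B) -> dir Z <> a (dir C) ->
  t (dir B) (dir C) (dir Z).
Proof.
move=> nB nC nZ h oBC oBZ oCZ.
have [e|ne] := EM (dir B = dir C).
  by rewrite (dir_convex nB nC nZ e h); exact: tl.
apply/dir_between => // X Y hX hY.
have [->|nX] := EM (X = A); first by exists A; [exact: ray_l|exact: bl].
have [->|nY] := EM (Y = A); first by exists A; [exact: ray_l|exact: br].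
have {oBC} oBC : ~ opposite A B C by move=> /dir_opposite-/(_ nB nC).
have {oBZ} oBZ : ~ opposite A B Z by move=> /dir_opposite-/(_ nB nZ).
have {oCZ} oCZ : ~ opposite A C Z by move=> /dir_opposite-/(_ nC nZ).
have oZB : ~ opposite A Z B by move/(opposite_sym btw).
have oZC : ~ opposite A Z C by move/(opposite_sym btw).
have [U hU hU'] : exists2 U, ray A Z U & s X C U.
  apply: (pasch_ray sp conn pasch nB nX nC nZ oBC oZB oZC hX).
  by exists Z => //; exact: ray_r.
have oCX : ~ opposite A C X.
  move/(opposite_sym btw)/(opposite_ray sp nX nC nB nC (ray_sym hX)) => o.
  by apply/oBC/o; exact: ray_r.
have oZX : ~ opposite A Z X.
  move/(opposite_ray sp nZ nX nZ nB (ray_r btw A Z)) => o.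
  by apply/oZB/o; exact: ray_sym.
have [|W hW hW'] := pasch_ray sp conn pasch nC nY nX nZ oCX oZC oZX hY.
  by exists U => //; exact: bsym.
by exists W => //; exact: bsym.
Qed.

Lemma dir_meets B C z : B <> A -> C <> A -> dir C <> a (dir B) ->
  t (dir B) (dir C) z -> exists Z, [/\ Z <> A, s B C Z & dir Z = z].
Proof.
move=> nB nC nopp; have [D nD ->] := dirP z.
have [e|ne] := EM (dir B = dir C).
  rewrite -e => /(between_id tbtw) ->; exists B; split=> //; exact: bl.
move=> /dir_between h.
have [W hW hW'] := h nB nC nD nopp ne B C (ray_r btw _ _) (ray_r btw _ _).
have nW : W <> A by move=> e; apply: (not_between_centre nB nC nopp); rewrite -e.
by exists W; split=> //; apply/esym/dir_eq.
Qed.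

(* A segment between directions r and w that met the antipode of r would carry
   a direction x between r and w which, by the Pasch condition, either lies
   between w and a r as well, or has a r on its way to w. *)
Lemma dir_avoids_antipode D W E : D <> A -> W <> A -> E <> A ->
  dir W <> a (dir D) -> s D W E -> dir E <> a (dir D).
Proof.
move=> nD nW nE nopp hE eE.
have aK := antipodeK tbtw two con; have aN := antipode_neq tbtw two.
have noanti := no_antipodes_between tbtw two con.
have [e|ne] := EM (dir D = dir W).
  by have := dir_convex nD nW nE e hE; rewrite eE => /aN.
have [x [hx xr xw]] := circle_dense tbtw con nopp ne.
have [U [nU hU eU]] := dir_meets nD nW nopp hx.
have xar : x <> a (dir D).
  by move=> e; apply: nopp; apply: (noanti _ _ (dir D)); [exact: tl|rewrite -e].
have wax : dir W <> a x.
  by move=> e; apply: nopp; apply: (noanti _ _ x) => //; rewrite -e; exact: tr.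
have xaw : x <> a (dir W) by move=> e; apply: wax; rewrite e aK.
have waE : dir W <> a (dir E) by rewrite eE aK; exact: nesym.
have Eaw : dir E <> a (dir W) by move=> e; apply: waE; rewrite e aK.
have Eax : dir E <> a x.
  by rewrite eE => e; apply: xr; rewrite -(aK x) -e aK.
have xaE : x <> a (dir E) by rewrite eE aK.
have [h|h] := between_cases btw hE hU.
  have := dir_pasch nU nW nE (between_inner btw hE h).
  rewrite eU => /(_ wax Eax Eaw) h1.
  apply: nopp; apply: (noanti _ _ (dir D)); first exact: tl.
  by rewrite -eE; exact: between_chain_r hx h1.
have := dir_pasch nE nW nU h; rewrite eU => /(_ waE xaE xaw) h1.
apply: (arcs_to_antipodes_disjoint tbtw two con parts (w := dir W) (q := dir D) (x := x)) => //.
- exact: nesym.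
- exact: tsym.
- by rewrite -eE; exact: tsym.
Qed.

Lemma dir_segment B C Z : B <> A -> C <> A -> dir C <> a (dir B) -> s B C Z ->
  Z <> A /\ t (dir B) (dir C) (dir Z).
Proof.
move=> nB nC nopp hZ.
have nZ : Z <> A by move=> e; apply: (not_between_centre nB nC nopp); rewrite -e.
have aK := antipodeK tbtw two con.
split=> //; apply: dir_pasch => //; first exact: dir_avoids_antipode hZ.
apply: (dir_avoids_antipode nC nB nZ _ (bsym hZ)).
by move=> e; apply: nopp; rewrite e aK.
Qed.

(** Let E be the first bad point. Points before E have the direction of M, so E has the antipodal
    direction: any direction strictly between the two would be met before E. A point W beyond E
    keeps the direction of E by [dir_avoids_antipode], so W is on the ray AE. Uniqueness of
    continuation at E then puts M on the ray AE, or another point of that ray on s[M, E], where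
    there is none. *)
Lemma through_from_centre M : M <> A -> through s A M.
Proof.
move=> nM N nN opp; apply: contrapT => bad.
have [E [rE nE bE gE]] := opposite_break sp conn (nesym nM) nN opp bad.
have good X : s M E X -> X <> E -> X <> A /\ dir X = dir M.
  move=> hX nX; have h := gE X hX nX.
  have nXA : X <> A by move=> e; apply: nM; apply: (between_id btw); rewrite -{2}e.
  by split=> //; apply/dir_eq => //; left.
have [X [hX XM XE]] := between_dense sp conn (nesym nE).
have not_back : ~ s A M E.
  move=> h; apply: XM; apply: (between_antisym btw (gE X hX XE)) => //.
  by apply: bsym; exact: between_chain (bsym h) hX.
have nEA : E <> A by move=> e; apply: not_back; rewrite e; exact: bl.
have dE : dir E <> dir M by move/dir_eq => /(_ nEA nM) [].
have oE : dir E = a (dir M).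
  apply: contrapT => nopp.
  have [z [hz z1 z2]] := circle_dense tbtw con nopp (nesym dE).
  have [Z [nZ hZ eZ]] := dir_meets nM nEA nopp hz.
  have [e|nZE] := EM (Z = E); first by apply: z2; rewrite -eZ e.
  by have [_] := good Z hZ nZE; rewrite eZ.
have [W [hW nWE]] := between_extend sp conn (nesym nE).
have nWA : W <> A.
  move=> e; rewrite e in hW; case: dE; apply/dir_eq => //; right; exact: bsym.
have dW : dir W <> dir M.
  by move=> /esym e; apply: dE; exact: dir_convex nM nWA nEA e hW.
have oW : dir E = dir W.
  rewrite oE; apply/esym; apply: contrapT => nopp.
  exact: dir_avoids_antipode nopp hW oE.
have back : opposite E W M.
  by apply: opposite_between => //; [exact: nesym|exact: bsym].
have /dir_eq-/(_ nEA nWA)[h|h] := oW; last first.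
  have : ray E A M.
    apply: (opposite_unique sp nWE (nesym nEA) (nesym nE)) back.
    by apply: opposite_between => //; [exact: nesym|exact: bsym].
  case=> h'; last by apply: nM; apply: (between_id btw); exact: gE (bsym h') (nesym nEA).
  by apply: dE; apply/dir_eq => //; left; exact: bsym.
have [W2 [nW2 h2 opp2]] := opposite_extend sp conn (nesym nEA).
have : ray E W2 M.
  apply: (opposite_unique sp nWE nW2 (nesym nE)) back.
  apply: (opposite_ray sp (nesym nEA) nW2 nWE nW2 _ (ray_r btw _ _)) opp2.
  by left; exact: bsym.
have nW2A : W2 <> A.
  by move=> e; rewrite e in h2; apply: nEA; exact: (between_id btw h2).
have dW2 : dir W2 = dir E by apply/dir_eq => //; left.
case=> h'.
  apply: dE; rewrite -dW2; apply/esym; apply: (dir_convex nW2A nEA nM dW2).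
  exact: bsym.
have [_ ] := good W2 (bsym h') nW2.
by rewrite dW2.
Qed.

(** Again a point W beyond the first bad point E has the direction of E. If W comes before E on the
    ray AE, then A is between D and W, which contradicts the order of D, E, W. If it comes after E,
    both A and D are opposite to W at E, hence on one ray from E. *)
Lemma through_centre D : D <> A -> through s D A.
Proof.
move=> nD N nN opp; apply: contrapT => bad.
have aN := antipode_neq tbtw two.
have [E [rE nE bE gE]] := opposite_break sp conn nD nN opp bad.
have oE : dir E = a (dir D).
  by rewrite -(proj2 (dir_eq nN nE) rE); apply/dir_opposite.
have dE : dir E <> dir D by rewrite oE.
have nDE : D <> E by move=> e; apply: dE; rewrite e.
have [W [hW nWE]] := between_extend sp conn nDE.
have nWA : W <> A.
  by move=> e; rewrite e in hW; apply: dE; apply/dir_eq => //; right; exact: bsym.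
have dW : dir W <> dir D.
  by move=> /esym e; apply: dE; exact: dir_convex nD nWA nE e hW.
have oW : dir E = dir W.
  rewrite oE; apply/esym; apply: contrapT => nopp.
  exact: dir_avoids_antipode nopp hW oE.
have /dir_eq-/(_ nE nWA)[h|h] := oW.
  have hA := gE W h nWE; have [h'|h'] := between_cases btw hA hW.
    by apply: dE; apply/dir_eq => //; right; exact: bsym.
  by apply: nWE; exact: (between_antisym btw h' h).
have : ray E A D.
  apply: (@opposite_unique _ _ sp E W) => //; try exact: nesym.
    by apply: opposite_between => //; [exact: nesym|exact: bsym].
  by apply: opposite_between => //; exact: bsym.
case=> h'; last by apply: bE; exact: bsym.
by apply: dE; apply/dir_eq => //; left; exact: bsym.
Qed.

Lemma line_dir P X : P <> A -> X <> A ->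
  line A P X <-> dir X = dir P \/ dir X = a (dir P).
Proof.
move=> nP nX; split=> [/(line_opposite btw nP nX)[h|h]|[h|h]].
- by left; apply/esym/dir_eq.
- by right; apply/dir_opposite.
- by left; apply/dir_eq.
- by right; apply: (through_centre nP nX); apply/dir_opposite.
Qed.

(** The sides are the cones over the two halves of the circle cut at the direction of P. A segment
    between them passes through A if its ends have antipodal directions; otherwise [halves_cross]
    names a direction of the line that it meets. *)
Lemma centre_line_separates P : P <> A -> exists h1 h2,
  convex_split s (~` line A P) h1 h2 /\
  forall C D, h1 C -> h2 D -> exists2 Z, s C D Z & line A P Z.
Proof.
move=> nP; have [c1 [c2 H]] := parts (dir P).
pose h (c : set (boundary s A)) : set T := [set X | X <> A /\ c (dir X)].
have convex_half c c' : halves t a (dir P) c c' -> convex s (h c).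
  move=> Hc X Y [nX hX] [nY hY] Z hZ.
  have nopp : dir Y <> a (dir X).
    by move=> e; apply: (half_no_antipodes tbtw two con Hc hX); rewrite -e.
  have [nZ tZ] := dir_segment nX nY nopp hZ.
  by split=> //; exact: (half_convex Hc hX hY tZ).
exists (h c1), (h c2); split.
  split.
  - apply/seteqP; split=> X.
      move=> hX; have nX : X <> A by move=> e; apply: hX; rewrite e; exact: line_l.
      have [n1 n2] : dir X <> dir P /\ dir X <> a (dir P).
        by split=> e; apply: hX; apply/line_dir; auto.
      by have [hc|hc] := halves_cover H n1 n2; [left|right].
    case=> -[nX hX] /(line_dir nP nX) hl.
      by have [n1 n2] := half_off H hX; case: hl.
    by have [n1 n2] := half_off (halves_sym H) hX; case: hl.
  - by apply/seteqP; split=> // X [[_ x1] [_ x2]]; exact: (halves_disjoint H x1 x2).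
  - case: H => [[_ _ [[z1 h1] [z2 h2]] _] _ _].
    have [[X1 n1 e1] [X2 n2 e2]] := (dirP z1, dirP z2).
    by split; [exists X1; split; rewrite // -e1|exists X2; split; rewrite // -e2].
  - by split; [exact: convex_half H|exact: convex_half (halves_sym H)].
move=> C D [nC hC] [nD hD].
have [e|nopp] := EM (dir D = a (dir C)).
  exists A; last exact: line_l.
  by apply: (through_centre nC nD); apply/dir_opposite.
by case: (halves_cross tbtw two con parts H hC hD nopp) => /(dir_meets nC nD nopp)
  [Z [nZ hZ eZ]]; exists Z => //; apply/line_dir => //; [left|right].
Qed.

(** The linear order on a half of the circle, in terms of points: of two rays on one side of AP, one
    runs inside the angle at A between P and the other. *)
Lemma centre_side_total P X Y : P <> A -> ~ line A P X -> ~ line A P Y ->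
  (forall Z, s X Y Z -> ~ line A P Z) ->
  (exists2 Z, ray A X Z & s P Y Z) \/ (exists2 Z, ray A Y Z & s P X Z).
Proof.
move=> nP oX oY miss.
have nX : X <> A by move=> e; apply: oX; rewrite e; exact: line_l.
have nY : Y <> A by move=> e; apply: oY; rewrite e; exact: line_l.
have [x1 x2] : dir X <> dir P /\ dir X <> a (dir P).
  by split=> e; apply: oX; apply/line_dir; auto.
have [y1 y2] : dir Y <> dir P /\ dir Y <> a (dir P).
  by split=> e; apply: oY; apply/line_dir; auto.
have [e|ne] := EM (dir X = dir Y).
  by left; exists Y; [apply/dir_eq|exact: br].
have [c1 [c2]] := parts (dir P).
wlog hX : c1 c2 / c1 (dir X) => [W H|H].
  by have [h|h] := halves_cover H x1 x2; [exact: W H|exact: W (halves_sym H)].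
have hY : c1 (dir Y).
  have [//|hY] := halves_cover H y1 y2.
  have [e|nopp] := EM (dir Y = a (dir X)).
    case: (miss A); last exact: line_l.
    by apply: (through_centre nX nY); apply/dir_opposite.
  by case: (halves_cross tbtw two con parts H hX hY nopp) =>
    /(dir_meets nX nY nopp)[Z [nZ hZ eZ]]; case: (miss Z hZ);
    apply/line_dir => //; [left|right].
have meet U V : U <> A -> V <> A -> dir V <> a (dir P) -> t (dir P) (dir V) (dir U) ->
    exists2 Z, ray A U Z & s P V Z.
  move=> nU nV nVP /(dir_meets nP nV nVP)[Z [nZ hZ eZ]].
  by exists Z => //; apply/dir_eq.
have [h|h] := half_total tbtw two con parts H hX hY ne; first by right; exact: meet.
by left; exact: meet.
Qed.

End Centre.

(** All that the remaining geometry takes from the circle, apart from one ray that yields a second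
    point of the space. *)
Theorem centre_lines (T : Type) (s : T -> T -> set T) (A : T) :
  pasch_space s -> (forall A B : T, connected_segment s (s A B)) ->
  is_circle (@boundary_betweenness T s A) ->
  [/\ forall M, M <> A -> through s A M, forall D, D <> A -> through s D A,
      forall P, P <> A -> exists h1 h2, convex_split s (~` line s A P) h1 h2 /\
        forall C D, h1 C -> h2 D -> exists2 Z, s C D Z & line s A P Z
    & forall P X Y, P <> A -> ~ line s A P X -> ~ line s A P Y ->
        (forall Z, s X Y Z -> ~ line s A P Z) ->
        (exists2 Z, ray s A X Z & s P Y Z) \/
        (exists2 Z, ray s A Y Z & s P X Z)].
Proof.
move=> pasch conn [tbtw [r0 _] [a [two con parts]]]; split.
- by move=> M; exact: (through_from_centre pasch conn r0 tbtw two con parts).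
- by move=> D; exact: (through_centre pasch conn r0 tbtw two con parts).
- by move=> P; exact: (centre_line_separates pasch conn r0 tbtw two con parts).
- by move=> P X Y; exact: (centre_side_total pasch conn r0 tbtw two con parts).
Qed.

(** * Lines and half-planes *)

Section Lines.
Context (T : Type) (s : T -> T -> set T) (pasch : pasch_space s).
Hypothesis conn : forall A B : T, connected_segment s (s A B).
Context (A : T).
Hypothesis from_centre : forall M, M <> A -> through s A M.
Hypothesis at_centre : forall D, D <> A -> through s D A.
Hypothesis separates : forall P, P <> A -> exists h1 h2,
  convex_split s (~` line s A P) h1 h2 /\
  forall C D, h1 C -> h2 D -> exists2 Z, s C D Z & line s A P Z.
Hypothesis side_total : forall P X Y, P <> A ->
  ~ line s A P X -> ~ line s A P Y -> (forall Z, s X Y Z -> ~ line s A P Z) ->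
  (exists2 Z, ray s A X Z & s P Y Z) \/ (exists2 Z, ray s A Y Z & s P X Z).

Let sp : maximal_rays_space s := pasch.1.
Let btw : is_betweenness s. Proof. by case: sp. Qed.
Local Notation bl := (between_l btw).
Local Notation br := (between_r btw).
Local Notation bsym := (between_sym btw).
Local Notation ray := (ray s).
Local Notation line := (line s).
Local Notation opposite := (opposite s).
Local Notation through := (through s).
Local Notation exchange := (line_exchange sp).

Lemma lineR P Q X : line P Q X -> line Q X P.
Proof. by move=> h; apply/(line_swap btw)/(lineC btw). Qed.

(** Needs straightness only as seen from A and beyond A, so it precedes [through_any]. *)
Lemma line_closed P U V W : P <> A -> line A P U -> line A P V -> U <> V ->
  line U V W -> line A P W.
Proof.
move=> nP hU hV nUV hW.
have [->|nW] := EM (W = A); first exact: line_l.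
have key X : X <> A -> line A P X -> line A X W -> line A P W.
  by move=> nX hX; apply: exchange => //; exact: at_centre.
have [eU|nU] := EM (U = A).
  by rewrite eU in hW nUV; apply: (key V) => // e; apply: nUV.
have [eV|nV] := EM (V = A).
  by rewrite eV in hW; apply: (key U) => //; exact: lineC.
have [->|nWU] := EM (W = U); first by [].
apply: (key U) => //; apply: (lineC btw).
apply: (exchange (nesym nU) (nesym nUV) nWU (from_centre nU) _ hW).
apply: (lineC btw); apply: (exchange nU nP nV (at_centre nU) _ hV).
exact: line_swap.
Qed.

(** * Sides of lines through A *)

Definition same_side P X Y :=
  [/\ ~ line A P X, ~ line A P Y & forall Z, s X Y Z -> ~ line A P Z].

Lemma same_side_sym P X Y : same_side P X Y -> same_side P Y X.
Proof. by case=> h1 h2 h3; split=> // Z /bsym; exact: h3. Qed.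

Lemma off_neq P X : ~ line A P X -> X <> A.
Proof. by move=> h e; apply: h; rewrite e; exact: line_l. Qed.

Lemma off_neq_base P X : ~ line A P X -> P <> A.
Proof. by move=> h e; apply: h; rewrite e; left; right; exact: bl. Qed.

Lemma same_side_dichotomy P X Y Z : ~ line A P X -> ~ line A P Y ->
  ~ line A P Z -> (same_side P X Y -> same_side P Y Z -> same_side P X Z) /\
  [\/ same_side P X Y, same_side P Y Z | same_side P X Z].
Proof.
move=> oX oY oZ; have [h1 [h2 [[e d _ [v1 v2]] cross]]] := separates (off_neq_base oX).
have off W : h1 W \/ h2 W -> ~ line A P W.
  by move=> hW; have : (h1 `|` h2) W by []; rewrite -e.
have cov W : ~ line A P W -> h1 W \/ h2 W.
  by move=> hW; have : (~` line A P) W by []; rewrite e.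
have s1 U V : h1 U -> h1 V -> same_side P U V.
  by move=> hU hV; split=> [||W hW]; apply: off; left => //; exact: v1 hW.
have s2 U V : h2 U -> h2 V -> same_side P U V.
  by move=> hU hV; split=> [||W hW]; apply: off; right => //; exact: v2 hW.
have s12 U V : h1 U -> h2 V -> ~ same_side P U V.
  by move=> hU hV [_ _ h]; have [W hW] := cross U V hU hV; exact: h.
have s21 U V : h1 U -> h2 V -> ~ same_side P V U.
  by move=> hU hV /same_side_sym; exact: s12.
have [[hX|hX] [[hY|hY] [hZ|hZ]]] := (cov X oX, (cov Y oY, cov Z oZ)).
all: split=> [k1 k2|]; try solve [exact: s1 | exact: s2
  | by case: (s12 X Y) | by case: (s21 Y X) | by case: (s12 Y Z) | by case: (s21 Z Y)].
all: try by apply: Or31; (exact: s1 || exact: s2).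
all: try by apply: Or32; (exact: s1 || exact: s2).
all: by apply: Or33; (exact: s1 || exact: s2).
Qed.

Lemma same_side_trans P X Y Z :
  same_side P X Y -> same_side P Y Z -> same_side P X Z.
Proof.
move=> h1 h2; case: (h1) (h2) => [oX oY _] [_ oZ _].
by have [h _] := same_side_dichotomy oX oY oZ; exact: h.
Qed.

Lemma side_cross P X Y : ~ line A P X -> ~ line A P Y -> ~ same_side P X Y ->
  exists2 Z, s X Y Z & line A P Z.
Proof.
move=> oX oY h; apply: contrapT => h'; apply: h; split=> // Z hZ hZ'.
by apply: h'; exists Z.
Qed.

Lemma same_side_between P X Y Z : same_side P X Y -> s X Y Z -> same_side P X Z.
Proof.
move=> [oX oY h] hZ; split=> //; first exact: h.
by move=> W hW; apply: h; exact: between_chain hW.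
Qed.

Lemma same_side_ray P M X Y : line A P M -> ~ line A P X -> Y <> M ->
  ray M X Y -> same_side P X Y.
Proof.
move=> hM oX nY hY; have nP := off_neq_base oX.
have nX : X <> M by move=> e; apply: oX; rewrite e.
have off Z : Z <> M -> ray M X Z -> ~ line A P Z.
  move=> nZ hZ oZ; apply: oX; apply: (line_closed nP hM oZ (nesym nZ)).
  exact/line_ray/ray_sym.
split=> //; first exact: off.
move=> Z hZ; have hZ' : ray M X Z by exact: (ray_convex sp nX (ray_r btw _ _) hY hZ).
apply: off => // e; apply: (opposite_irrefl sp nX).
apply: (opposite_ray sp nX nY nX nX (ray_r btw _ _) (ray_sym hY)).
by apply: opposite_between; rewrite // -e.
Qed.

Lemma opposite_sides P M X Y : line A P M -> ~ line A P X -> Y <> M ->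
  s X Y M -> ~ line A P Y /\ ~ same_side P X Y.
Proof.
move=> hM oX nY h; split; last by case=> _ _ /(_ M h).
move=> oY; apply: (oX); apply: (line_closed (off_neq_base oX) hM oY (nesym nY)).
by apply: line_swap => //; right.
Qed.

(** With the two lemmas that follow, supplies the conditions of [pasch_ray]: two rays from a point
    of AP into the same side are not opposite, nor are a ray along AP and one off it. *)
Lemma not_opposite_same_side P O X Y : line A P O -> same_side P X Y ->
  ~ opposite O X Y.
Proof.
move=> hO hXY [B [C [hB hC nB nC h]]]; have [oX oY _] := hXY.
have hXB := same_side_ray hO oX nB hB; have hYC := same_side_ray hO oY nC hC.
have := same_side_trans (same_side_sym hXB) (same_side_trans hXY hYC).
by case=> _ _ /(_ O h).
Qed.

Lemma not_opposite_off P O Q X : line A P O -> line A P Q -> Q <> O ->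
  ~ line A P X -> ~ opposite O Q X.
Proof.
move=> hO hQ nQ oX [B [C [hB hC nB nC h]]].
have nP := off_neq_base oX.
have hB' : line A P B by apply: (line_closed nP hO hQ (nesym nQ)); left.
have hC' : line A P C.
  by apply: (line_closed nP hO hB' (nesym nB)); right.
have [_ oC _] := same_side_ray hO oX nC hC.
exact: oC.
Qed.

Lemma not_opposite_off' P O Q X : line A P O -> line A P Q -> Q <> O ->
  ~ line A P X -> ~ opposite O X Q.
Proof. by move=> h1 h2 h3 h4 /(opposite_sym btw); exact: (not_opposite_off h1 h2 h3 h4). Qed.


(** * Straight continuation and uniqueness of lines *)

Lemma through_centre_line P D M : P <> A -> line A P D -> line A P M -> D <> M ->
  through D M.
Proof.
move=> nP hD hM nDM.
have [eD|nD] := EM (D = A).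
  by rewrite eD in nDM *; apply: from_centre; exact: nesym.
have [eM|nM] := EM (M = A); first by rewrite eM; exact: at_centre.
have nMA := nesym nM.
have key : line M A D.
  apply: (lineC btw); apply: (exchange nM nP nD (at_centre nM) _ hD).
  exact: line_swap.
move=> N nN opp.
have NA : ray M A D -> s A N M.
  move=> h; apply: from_centre => //.
  by apply: (opposite_ray sp nDM nN nMA nN (ray_sym h) (ray_r btw _ _)) opp.
(* The cases are: D between M and A, A between M and D, M between A and D. *)
have [[h|h]|h] := key.
- exact: between_inner (NA (or_introl h)) (bsym h).
- have hN := NA (or_intror h); apply: (fun h => between_chain_r btw h hN).
  have nNA : N <> A.
    by move=> e; move: hN; rewrite e => /(between_id btw).
  apply: at_centre => //.
  have o : opposite A D M by apply: opposite_between => //; exact: bsym.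
  by apply: (opposite_ray sp nD nM nD nNA (ray_r btw _ _) _ o); right.
have : ray M A N.
  apply: (opposite_unique sp nDM nMA nN) opp.
  by apply: opposite_between => //; exact: bsym.
case=> hN; first exact: between_inner_r (bsym h) hN.
have [->|nNA] := EM (N = A); first exact: bsym.
have o : opposite A M N by exact: opposite_between.
have hDN : s D N A.
  apply: at_centre => //.
  by apply: (opposite_ray sp nM nNA nD nNA _ (ray_r btw _ _) o); right.
by apply: (between_chain btw hDN); exact: bsym.
Qed.

Local Notation pray := (pasch_ray sp conn pasch).

(* Case E off the line AD: the line AM crosses s[D, E] at some M', and a ray from D
   through a point between M and M' would have to meet s[M, E] twice. *)
Lemma break_off_line D M E : ~ line A D M -> ~ line A D E -> E <> M ->
  ~ s D E M -> (forall X, s M E X -> X <> E -> s D X M) -> False.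
Proof.
move=> oM oE nEM bE gE.
have nM := off_neq oM.
have oD : ~ line A M D by move=> h; apply: oM; exact: line_swap.
have nDM : D <> M by move=> e; apply: oM; rewrite e; exact: line_r.
have onD : line A D D by exact: line_r.
have onM : line A M M by exact: line_r.
have good X : s M E X -> X <> E -> same_side D M X.
  move=> hX nX; apply: (same_side_ray onD oM); last by right; exact: gE.
  by move=> e; apply: nDM; move: (gE X hX nX); rewrite e => /(between_id btw).
have sME : same_side D M E.
  split=> // Z hZ; have [->//|nZ] := EM (Z = E).
  by have [] := good Z hZ nZ.
have [X [hX XM XE]] := between_dense sp conn (nesym nEM).
have hDX := gE X hX XE.
have [oX nDX] := opposite_sides onM oD XM hDX.
have sXE : same_side M X E by apply: (same_side_ray onM oX nEM); right; exact: hX.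
have [_ oE' _] := sXE.
have nDE : ~ same_side M D E.
  by move=> h; apply: nDX; exact: same_side_trans h (same_side_sym sXE).
have [M1 hM1 onM1] := side_cross oD oE' nDE.
have M1M : M1 <> M by move=> e; apply: bE; rewrite -e.
have M1D : M1 <> D by move=> e; apply: oD; rewrite -e.
have [M2 [hM2 M2M M2M1]] := between_dense sp conn (nesym M1M).
have onM2 : line A M M2.
  by apply: (line_closed nM onM onM1 (nesym M1M)); left; left.
have sM1 : same_side D M M1.
  apply: (same_side_trans sME); apply: (same_side_ray onD oE M1D).
  by left.
have sM2 : same_side D M M2 := same_side_between sM1 hM2.
have sX := good X hX XE.
have M2D : M2 <> D by move=> e; apply: oD; rewrite -e.
have ED : E <> D by move=> e; apply: oE; rewrite e.
have XD : X <> D by case: sX => _ oDX _ e; apply: oDX; rewrite e.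
have sM21 := same_side_trans (same_side_sym sM2) sM1.
have nos U V : same_side D U V -> ~ opposite D U V.
  exact: not_opposite_same_side onD.
(* Pasch at D carries the crossing of the ray DM2 from s[M, M1] to s[X, M1], at Y, and on to
   s[E, X], at Z. Wherever Z is, the ray contains M2 and one of M and M1, so D would be on AM. *)
have [Y hY hY'] := pray (nesym nDM) XD M1D M2D (nos _ _ sM1)
  (nos _ _ (same_side_sym sM2)) (nos _ _ sM21) (or_intror hDX)
  (ex_intro2 _ _ M2 (ray_r btw _ _) hM2).
have sX1 := same_side_trans (same_side_sym sX) sM1.
have sM2X := same_side_trans (same_side_sym sM2) sX.
have [Z hZ hZ'] := pray M1D ED XD M2D (nos _ _ (same_side_sym sX1))
  (nos _ _ sM21) (nos _ _ sM2X) (or_intror hM1)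
  (ex_intro2 _ _ Y hY (bsym hY')).
have two_points U V : line A M U -> line A M V -> U <> V -> ray D U V -> False.
  move=> hU hV nUV h; apply: oD; apply: (line_closed nM hU hV nUV).
  exact/lineR/line_ray.
have [eZ|nZ] := EM (Z = E).
  apply: (two_points M2 M1) => //; apply: (ray_trans sp ED); last by left.
  by rewrite -eZ.
have hMZ : s M E Z by apply: (between_chain_r btw hX); exact: bsym.
have ZD : Z <> D by case: (good Z hMZ nZ) => _ oDZ _ e; apply: oDZ; rewrite e.
apply: (two_points M2 M) => //; apply: (ray_trans sp ZD hZ); left; exact: gE.
Qed.

(* Case E on the line AD: then A is between D and E.  Past E on that line take
   E2; the ray AX leaves the triangle M, E, E2 at some X2 beyond X, so the ray DM
   enters the triangle D, X2, E2 and must meet s[X2, E2], where it cannot. *)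
Lemma break_on_line D M E : ~ line A D M -> line A D E -> E <> M ->
  ~ s D E M -> (forall X, s M E X -> X <> E -> s D X M) -> False.
Proof.
move=> oM onE nEM bE gE.
have nD := off_neq_base oM; have nM := off_neq oM.
have oD : ~ line A M D by move=> h; apply: oM; exact: line_swap.
have nDM : D <> M by move=> e; apply: oM; rewrite e; exact: line_r.
have onD : line A D D by exact: line_r.
have onM : line A M M by exact: line_r.
have onA P : line A P A by exact: line_l.
have [X [hX0 XM XE]] := between_dense sp conn (nesym nEM).
have hDX := gE X hX0 XE.
have XD : X <> D.
  by move=> e; apply: nDM; move: hDX; rewrite e => /(between_id btw).
have [oX nDX] := opposite_sides onM oD XM hDX.
have XA := off_neq oX.
have sMX : same_side D M X by apply: (same_side_ray onD oM XD); right.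
have [_ oDX _] := sMX.
have oXM : ~ line A X M by move=> h; apply: oX; exact: line_swap.
have nEA : E <> A.
  move=> e; rewrite e in hX0; apply: oX; apply: (line_closed nM onM (onA M) nM).
  by left; left.
have nED : E <> D.
  move=> e; apply: XM; rewrite e in hX0.
  exact: esym (between_antisym btw (bsym hX0) hDX).
have oEM : ~ line A M E.
  move=> h; apply: oD; apply: (line_closed nM (onA M) h (nesym nEA)).
  exact: line_swap.
have sXE : same_side M X E by apply: (same_side_ray onM oX nEM); right.
have nDE : ~ same_side M D E.
  by move=> h; apply: nDX; exact: same_side_trans h (same_side_sym sXE).
have hDE : s D E A.
  have [Z hZ onZ] := side_cross oD oEM nDE.
  have [<-//|nZ] := EM (Z = A).
  exfalso; apply: oD; apply: (line_closed nM (onA M) onZ (nesym nZ)).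
  apply: (line_swap btw); apply: (line_closed nD onD onE (nesym nED)).
  by left; left.
have [E2 [nE2 hE2 _]] := opposite_extend sp conn (nesym nEA).
have E2A : E2 <> A by move=> e; apply: nEA; move: hE2; rewrite e => /(between_id btw).
have onE2 : line A D E2.
  by apply: (line_closed nD (onA D) onE (nesym nEA)); left; right.
have hDE2 : s D E2 A.
  apply: at_centre => //.
  have o : opposite A D E by exact: opposite_between.
  by apply: (opposite_ray sp nD nEA nD E2A (ray_r btw _ _) _ o); right.
have E2D : E2 <> D by move=> e; apply: nD; move: hDE2; rewrite e => /(between_id btw).
have off2 Z : Z <> A -> ray A X Z -> same_side D X Z.
  by move=> nZ; exact: same_side_ray.
have [X2 hX2 hX2'] : exists2 X2, ray A X X2 & s E2 M X2.
  apply: (pray nEA E2A nM XA (not_opposite_off (onA D) onE nEA oM)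
    (not_opposite_off' (onA D) onE nEA oDX)
    (not_opposite_same_side (onA D) (same_side_sym sMX)) (or_intror hE2)).
  by exists X; [exact: ray_r|exact: bsym].
have X2A : X2 <> A.
  move=> e; rewrite e in hX2'; apply: oM.
  by apply: (line_closed nD (onA D) onE2 (nesym E2A)); right.
have X2M : X2 <> M by move=> e; apply: oXM; rewrite -e; exact: line_ray.
have E2M : E2 <> M by move=> e; apply: oM; rewrite -e.
have sEE2 : same_side M E E2.
  by apply: (same_side_ray (onA M) oEM E2A); right.
have [_ oME2 _] := sEE2.
(* Pasch at M: the ray ME meets s[E2, A] at E, hence also s[X2, A], and the lines AX and ME share
   only X. *)
have hX : s X2 A X.
  have [X3 hX3 hX3'] : exists2 X3, ray M E X3 & s X2 A X3.
    apply: (pray E2M X2M (nesym nM) nEM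
      (not_opposite_off' onM (onA M) (nesym nM) oME2)
      (not_opposite_same_side onM sEE2)
      (not_opposite_off' onM (onA M) (nesym nM) oEM) (or_introl (bsym hX2'))).
    by exists E; [exact: ray_r|exact: bsym].
  have [<-//|nX3] := EM (X3 = X).
  exfalso; apply: oXM.
  have hAX3 : line A X X3.
    by apply: line_ray; apply: (ray_sub btw hX2); exact: bsym.
  apply: (line_closed XA (line_r btw A X) hAX3 (nesym nX3)).
  by apply/lineR/line_ray; exact: (ray_total sp nEM (or_introl hX0) hX3).
have sXX2 := off2 X2 X2A hX2; have [_ oX2 _] := sXX2.
have X2D : X2 <> D by move=> e; apply: oX2; rewrite e.
have [J hJ hJ'] : exists2 J, ray D M J & s E2 X2 J.
  apply: (pray (nesym nD) E2D X2D (nesym nDM)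
    (not_opposite_off onD (onA D) (nesym nD) oX2)
    (not_opposite_off' onD (onA D) (nesym nD) oM)
    (not_opposite_same_side onD (same_side_trans sMX sXX2)) (or_intror hDE2)).
  by exists X; [right|exact: bsym].
have JM : J <> M.
  by move=> e; apply: X2M; rewrite e in hJ'; exact: between_antisym hJ' hX2'.
have hMJ : ray M J E2 by right; apply: bsym; exact: between_chain hX2' hJ'.
(* As J is in s[M, E2], the ray MJ contains E2; it also contains D or E, depending on the order of
   D, M and J. Two points of AD on one ray from M put M on AD. *)
have no_line Y : line A D Y -> Y <> E2 -> ray M Y E2 -> False.
  move=> onY nY h; apply: oM; apply: (line_closed nD onY onE2 nY).
  exact/lineR/line_ray.
case: hJ => h.
  apply: (no_line D onD (nesym E2D)); apply: (ray_trans sp JM _ hMJ).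
  by left; exact: bsym.
apply: (no_line E onE (nesym nE2)); apply: (ray_trans sp JM _ hMJ).
apply: (ray_trans sp XM (or_introl hX0)).
by apply: (opposite_unique sp nDM XM JM); exact: opposite_between.
Qed.

(** With this every local line is a line, and two distinct points of a line determine it
    ([lineE]). *)
Lemma through_any D M : D <> M -> through D M.
Proof.
move=> nDM.
have [eD|nD] := EM (D = A).
  by rewrite eD in nDM *; apply: from_centre; exact: nesym.
have [onM|oM] := EM (line A D M).
  by apply: (through_centre_line nD) => //; exact: line_r.
move=> N nN opp; apply: contrapT => bad.
have [E [_ nE bE gE]] := opposite_break sp conn nDM nN opp bad.
have [onE|oE] := EM (line A D E); first exact: (break_on_line oM onE nE bE gE).
exact: (break_off_line oM oE nE bE gE).
Qed.

Lemma line_base B C U : B <> C -> U <> B -> line B C U -> line B C = line B U.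
Proof.
move=> nBC nU hU; have nCB := nesym nBC.
apply/seteqP; split=> X hX; (have [->|nX] := EM (X = B); first exact: line_l).
  apply: (exchange nU nCB nX (through_any nU) _ hX).
  exact: line_swap.
exact: (exchange nCB nU nX (through_any nCB) hU hX).
Qed.

Lemma lineE B C U V : B <> C -> line B C U -> line B C V -> U <> V ->
  line B C = line U V.
Proof.
move=> nBC; wlog nU : U V / U <> B => [W|] hU hV nUV.
  have [eU|nU] := EM (U = B); last exact: W.
  rewrite eU; apply: line_base => // eV; by apply: nUV; rewrite eU eV.
have swap X Y : line X Y = line Y X.
  by apply/seteqP; split=> Z; exact: lineC.
rewrite (line_base nBC nU hU) in hV *; rewrite swap in hV *.
by apply: line_base => //; exact: nesym.
Qed.

Lemma line_extend B C U V X : B <> C -> line B C U -> line B C V -> U <> V ->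
  line U V X -> line B C X.
Proof. by move=> nBC hU hV nUV; rewrite (lineE nBC hU hV nUV). Qed.

Lemma line_convex B C : B <> C -> convex s (line B C).
Proof.
move=> nBC X Y hX hY Z hZ; have [eXY|nXY] := EM (X = Y).
  by move: hZ; rewrite -eXY => /(between_id btw) ->.
by apply: (line_extend nBC hX hY nXY); left; left.
Qed.

(** * The two sides of a line avoiding A *)

Section Separation.
Context (B C : T) (nBC : B <> C).
Local Notation l := (line B C).
Hypothesis lA : ~ l A.

Let on_neq X : l X -> X <> A.
Proof. by move=> h e; apply: lA; rewrite -e. Qed.

Let on_unique X Y : l X -> l Y -> line A X Y -> X = Y.
Proof.
move=> hX hY h; apply: contrapT => nXY; apply: lA.
by apply: (line_extend nBC hX hY nXY); exact: lineR.
Qed.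

Let on_line X Y Z : l X -> l Y -> X <> Y -> line X Y Z -> l Z.
Proof. exact: line_extend nBC. Qed.

Let on_ray X Y Z : l X -> l Y -> X <> Y -> ray X Y Z -> l Z.
Proof. by move=> hX hY nXY h; apply: (on_line hX hY nXY); left. Qed.

Lemma line_other P : l P -> exists Q, [/\ l Q, Q <> P & ~ line A P Q].
Proof.
move=> hP; have [Q hQ nQ] : exists2 Q, l Q & Q <> P.
  have [e|nP] := EM (B = P); last by exists B => //; exact: line_l.
  by exists C; [exact: line_r|rewrite -e; exact: nesym].
by exists Q; split=> // h; apply: nQ; apply/esym; exact: on_unique.
Qed.

Lemma line_both_sides P X : l P -> ~ line A P X -> exists Q Q',
  [/\ l Q, l Q' /\ Q' <> P, same_side P X Q & s Q Q' P /\ ~ same_side P X Q'].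
Proof.
move=> hP oX; have [Q [hQ nQ oQ]] := line_other hP.
have [Q' [nQ' h _]] := opposite_extend sp conn nQ.
have hQ' : l Q' by apply: (on_line hQ hP nQ); left; right.
have [oQ' nQQ'] := opposite_sides (line_r btw A P) oQ nQ' h.
have [_ dich] := same_side_dichotomy oQ oX oQ'.
have [k|k] := EM (same_side P X Q).
  exists Q, Q'; split=> //; split=> // k'; apply: nQQ'.
  exact: same_side_trans (same_side_sym k) k'.
exists Q', Q; split=> //; last by split=> //; exact: bsym.
by case: dich => // /same_side_sym.
Qed.

Definition near X := ~ l X /\ forall Z, s A X Z -> ~ l Z.
Definition far X := ~ l X /\ exists2 Z, s A X Z & l Z.

(** Let s[A, X] meet l at P, let Y be off AX, and take L on l on the side of Y. If the ray AY
    crosses s[P, L], it does so beyond Y, and Pasch at the crossing finishes. Otherwise AL crosses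
    s[P, Y] at F, hence s[X, Y] at some G, and the order of A, F, G, L decides. *)
Lemma far_near_cross X Y : far X -> near Y -> exists2 Z, s X Y Z & l Z.
Proof.
move=> [lX [P hP onP]] [lY miss].
have nP := on_neq onP; have nPA := nesym nP.
have PX : P <> X by move=> e; apply: lX; rewrite -e.
have nX : X <> A by move=> e; move: hP; rewrite e => /(between_id btw).
have [onY|oY0] := EM (line A X Y).
  case: (lineP onY) => h.
  - have [h'|h'] := between_cases btw h hP; first by case: (miss P).
    by exists P => //; exact: bsym.
  - by case: (miss P) => //; exact: between_chain hP.
  - by exists P => //; apply: (between_chain btw h); exact: bsym.
have aP : line A P P by exact: line_r.
have aA Q : line A Q A by exact: line_l.
have aX : line A P X by left; right.
have oY : ~ line A P Y.
  move=> h; apply: oY0; apply: (line_closed nX (aA X) _ nPA h).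
  by left; left.
have [L [_ [onL _ sL _]]] := line_both_sides onP oY.
have [_ oL _] := sL.
have PL : P <> L by move=> e; apply: oL; rewrite -e.
have LP := nesym PL.
have rayL Z : ray P L Z -> l Z by exact: on_ray.
have nL := off_neq oL; have nY := off_neq oY.
have nAX := nesym nX.
have XL' : L <> X by move=> e; apply: lX; rewrite -e.
have YP : Y <> P by move=> e; apply: lY; rewrite e.
have [[F hF hF']|[F hF hF']] := side_total nP oY oL (let: And3 _ _ h := sL in h).
  have onF : l F by apply: rayL; left.
  case: hF => hF; first by case: (miss F).
  have nF := on_neq onF; have YF : Y <> F by move=> e; apply: lY; rewrite e.
  have FP : F <> P.
    by move=> e; apply: oY; left; left; rewrite -e.
  have oFP : ~ line A F P by move=> /(on_unique onF onP).
  have sPX : same_side F P X by apply: (same_side_ray (aA F) oFP nX); right.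
  have [_ oFX _] := sPX.
  have XF : X <> F by move=> e; apply: lX; rewrite e.
  have onFF : line A F F by exact: line_r.
  have [Z hZ hZ'] := pray (nesym nF) YF XF (nesym FP)
    (not_opposite_off onFF (aA F) (nesym nF) oFX)
    (not_opposite_off' onFF (aA F) (nesym nF) oFP)
    (not_opposite_same_side onFF sPX) (or_introl (bsym hF))
    (ex_intro2 _ _ P (ray_r btw _ _) hP).
  by exists Z; [exact: bsym|exact: on_ray onF onP FP hZ].
have nF : F <> A.
  by move=> e; apply: oY; right; rewrite -e.
have sLF : same_side P L F by exact: same_side_ray.
have [_ oF _] := sLF.
have FP : F <> P by move=> e; apply: oF; rewrite e.
have nosP U V : same_side P U V -> ~ opposite P U V.
  exact: not_opposite_same_side aP.
have [G hG hG'] := pray nP nX nY nL (not_opposite_off (aA P) aP nP oY)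
    (not_opposite_off' (aA P) aP nP oL)
    (not_opposite_same_side (aA P) (same_side_sym sL)) (or_intror hP)
    (ex_intro2 _ _ F hF hF').
have nG : G <> A by move=> e; apply: oY0; right; rewrite -e.
have sLG : same_side P L G by exact: same_side_ray.
have [_ oG _] := sLG.
have GP : G <> P by move=> e; apply: oG; rewrite e.
have GX : G <> X by move=> e; apply: oG; rewrite e.
have PLL : ray P L L by exact: ray_r.
(* If L is between A and F, Pasch at P makes l meet s[A, Y], but Y is near. *)
case: hF => [hLF|hFL]; last first.
  have [Z hZ hZ'] := pray FP YP nPA LP
      (not_opposite_off' aP (aA P) nPA oF) (nosP _ _ sLF)
      (not_opposite_off' aP (aA P) nPA oL) (or_intror hF')
      (ex_intro2 _ _ L PLL (bsym hFL)).
  by case: (miss Z); [exact: bsym|exact: rayL].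
(* If L is between F and G, Pasch at P makes l meet s[Y, G], a part of s[X, Y]. *)
case: hG => [hLG|hGL]; last first.
  have hL : s F G L by exact: between_inner hGL hLF.
  have [Z hZ hZ'] := pray FP YP GP LP
      (nosP _ _ (same_side_trans (same_side_sym sLF) sLG)) (nosP _ _ sLF)
      (nosP _ _ sLG) (or_intror hF') (ex_intro2 _ _ L PLL hL).
  exists Z; last exact: rayL.
  exact: bsym (between_chain btw (bsym hG') hZ').
have [eGL|nGL] := EM (G = L); first by exists G; rewrite // eGL.
(* With G between A and L, Pasch at X makes the ray XG meet l at J. Were J beyond Y, then s[X, J]
   would cross AL at G, although X, P and J are on one side of AL. *)
have [J hJ hJ'] := pray nAX PX XL' GX (not_opposite_off aX (aA P) nAX oL)
    (not_opposite_off' aX (aA P) nAX oG)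
    (not_opposite_same_side aX (same_side_sym sLG)) (or_introl (bsym hP))
    (ex_intro2 _ _ G (ray_r btw _ _) hLG).
have onJ : l J by apply: rayL; left.
have [h|h] := ray_trans sp GX (or_introl hG') hJ; first by exists J.
exfalso; have oLX : ~ line A L X.
  move=> k; apply: oL; apply: (line_closed nP (aA P) aX nAX).
  exact: line_swap.
have onLG : line A L G by left; left.
have JL : J <> L.
  move=> e; apply: oLX; apply: (line_closed nL onLG (line_r btw A L) nGL).
  by apply/lineR/line_ray; rewrite -e.
have sXP : same_side L X P by apply: (same_side_ray (aA L) oLX nP); left.
have [_ oLP _] := sXP.
have sPJ : same_side L P J.
  apply: (same_side_ray (line_r btw A L) oLP JL); left; exact: bsym.
have [_ _ /(_ G)] := same_side_trans sXP sPJ.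
by apply=> //; exact: between_chain h hG'.
Qed.

(* The two pairs of crossing lines PQ, UV would meet twice: besides F, the ray
   UQ meets s[P, F]. *)
Lemma no_quadrilateral P Q U V F : s A U P -> P <> U -> s A V Q -> Q <> A ->
  ~ line A U V -> s P Q F -> F <> P -> F <> Q -> s U V F -> F <> U -> False.
Proof.
move=> hP PU hQ nQ oV hF FP FQ hF' FU.
have nU := off_neq_base oV; have nAU := nesym nU.
have aA W : line A W A by exact: line_l.
have aU : line A U U by exact: line_r.
have aP : line A U P by left; left.
have sVQ : same_side U V Q by apply: (same_side_ray (aA U) oV nQ); left.
have [_ oQ _] := sVQ.
have VU : V <> U by move=> e; apply: oV; rewrite e.
have QU : Q <> U by move=> e; apply: oQ; rewrite e.
have oQV := not_opposite_same_side aU (same_side_sym sVQ).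
have [Z hZ hZ'] := pray nAU PU VU QU (not_opposite_off aU (aA U) nAU oV)
    (not_opposite_off' aU (aA U) nAU oQ) oQV (or_introl (bsym hP))
    (ex_intro2 _ _ Q (ray_r btw _ _) hQ).
have [K hK hK'] := pray VU FU PU QU (not_opposite_off' aU aP PU oV) oQV
    (not_opposite_off' aU aP PU oQ) (or_introl hF')
    (ex_intro2 _ _ Z hZ (bsym hZ')).
have PQ : P <> Q by move=> e; apply: oQ; rewrite -e.
have KQ : K <> Q.
  move=> e; rewrite e in hK'; apply: FQ.
  exact: (between_antisym btw (bsym hK') hF).
have hU : line P Q U.
  have hPQK : line P Q K by left; left; apply: (between_chain btw hF); exact: bsym.
  apply: (line_extend PQ (line_r btw P Q) hPQK (nesym KQ)).
  exact/lineR/line_ray.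
apply: oQ; apply: (line_closed nU aP aU PU).
exact: line_swap.
Qed.

(* On the side of X, the line l leaves the angle at A between F and X. *)
Lemma line_beyond F X L : near X -> l F -> l L -> same_side F X L ->
  exists U P, [/\ ray F L U, U <> F, ray F X P, P <> F & s A U P /\ P <> U].
Proof.
move=> [lX miss] onF onL sXL; have [oX oL _] := sXL.
have nF := on_neq onF.
have aF : line A F F by exact: line_r.
have aA : line A F A by exact: line_l.
have FX : X <> F by move=> e; apply: oX; rewrite e.
have FL : L <> F by move=> e; apply: oL; rewrite e.
have [[J hJ hJ']|[G hG hG']] := side_total nF oX oL (let: And3 _ _ h := sXL in h).
  have onJ : l J by apply: (on_ray onF onL (nesym FL)); left.
  case: hJ => hJ; first by case: (miss J).
  exists J, X; split=> //; first by left.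
  - by move=> e; apply: oX; left; left; rewrite -e.
  - exact: ray_r.
  - by split=> // e; apply: lX; rewrite e.
have nG : G <> A by move=> e; apply: oX; right; rewrite -e.
have sLG : same_side F L G by exact: (same_side_ray aA oL nG hG).
have [_ oG _] := sLG.
have GF : G <> F by move=> e; apply: oG; rewrite e.
case: hG => [hLG|hGL].
  exists L, G; split=> //; [exact: ray_r|by left|split=> // e].
  by apply: lX; apply: (on_ray onF onL (nesym FL)); rewrite -e; right.
have [Z hZ hZ'] := pray GF FX (nesym nF) FL
    (not_opposite_off' aF aA (nesym nF) oG)
    (not_opposite_same_side aF sLG) (not_opposite_off' aF aA (nesym nF) oL)
    (or_intror hG') (ex_intro2 _ _ L (ray_r btw _ _) (bsym hGL)).
by case: (miss Z); [exact: bsym|exact: on_ray onF onL (nesym FL) hZ].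
Qed.

(** If F were on l, [line_beyond] on both sides of AF would give U, V on l and P, Q on the line XY
    with U between A and P and V between A and Q, while F is between U and V and between P and Q:
    the figure of [no_quadrilateral]. *)
Lemma near_segment X Y F : near X -> near Y -> s X Y F -> ~ l F.
Proof.
move=> nX nY hF onF; have [lX missX] := nX; have [lY missY] := nY.
have FX : X <> F by move=> e; apply: lX; rewrite e.
have FY : Y <> F by move=> e; apply: lY; rewrite e.
have XY : X <> Y.
  by move=> e; apply: FX; move: hF; rewrite e => /(between_id btw).
have aF : line A F F by exact: line_r.
have [onX|oX] := EM (line A F X).
  have XA : X <> A by move=> e; case: (missY F) => //; rewrite -e.
  have h : line X Y A.
    apply: (exchange (V := Y) (X := F)).
    - exact: nesym.
    - exact: nesym.
    - exact: nesym.
    - by apply: through_any; exact: nesym.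
    - by left; left.
    - by apply/(lineC btw)/lineR.
  case: (lineP h) => k.
  - have [k'|k'] := between_cases btw k hF.
      by case: (missX F) => //; exact: bsym.
    by case: (missY F).
  - by case: (missX F) => //; apply: bsym; exact: between_chain k hF.
  - by case: (missY F) => //; apply: bsym; apply: (between_chain btw k); exact: bsym.
have [oY nXY] := opposite_sides aF oX FY hF.
have [L [L' [onL [onL' L'F] sL [hL nL']]]] := line_both_sides onF oX.
have oL : ~ line A F L by case: sL.
have LF : L <> F by move=> e; apply: oL; rewrite e.
have [oL' nLL'] := opposite_sides aF oL L'F hL.
have sY : same_side F Y L'.
  have [_ []] := same_side_dichotomy oX oY oL'; first by [].
  - by [].
  - by [].
have [U [P [hU UF hP PF [hAU PU]]]] := line_beyond nX onF onL sL.
have [V [Q [hV VF hQ QF [hAV QV]]]] := line_beyond nY onF onL' sY.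
have onU : l U by exact: on_ray onF onL (nesym LF) hU.
have onV : l V by exact: on_ray onF onL' (nesym L'F) hV.
have hPQ : s P Q F.
  apply: through_any => //.
  by apply: (opposite_ray sp FX FY PF QF hP hQ); exact: opposite_between.
have hUV : s U V F.
  apply: through_any => //.
  by apply: (opposite_ray sp LF L'F UF VF hU hV); exact: opposite_between.
have UV : U <> V.
  by move=> e; apply: UF; move: hUV; rewrite e => /(between_id btw).
apply: (no_quadrilateral hAU PU hAV _ _ hPQ (nesym PF) (nesym QF) hUV (nesym UF)).
- by move=> e; apply: oY; apply/lineR/lineR/line_ray; rewrite -e.
- by move=> h; apply: UV; exact: on_unique.
Qed.

(** Let l meet s[A, X] at P and s[A, Y] at Q. If A, X, Y are not collinear, two uses of Pasch at A
    bring a point Z of l on s[X, Y] into s[P, Q], which again gives the figure of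
    [no_quadrilateral]. *)
Lemma far_segment X Y Z : far X -> far Y -> s X Y Z -> ~ l Z.
Proof.
move=> [lX [P hP onP]] [lY [Q hQ onQ]] hZ onZ.
have nP := on_neq onP; have nQ := on_neq onQ; have nZ := on_neq onZ.
have PX : P <> X by move=> e; apply: lX; rewrite -e.
have QY : Q <> Y by move=> e; apply: lY; rewrite -e.
have ZX : Z <> X by move=> e; apply: lX; rewrite -e.
have ZY : Z <> Y by move=> e; apply: lY; rewrite -e.
have nX : X <> A by move=> e; move: hP; rewrite e => /(between_id btw).
have nY : Y <> A by move=> e; move: hQ; rewrite e => /(between_id btw).
have XY : X <> Y.
  by move=> e; apply: ZX; move: hZ; rewrite e => /(between_id btw).
have aX : line A X X by exact: line_r.
have aA W : line A W A by exact: line_l.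
have aP : line A X P by left; left.
have [onY|oY] := EM (line A X Y).
  have onQX : line A X Q.
    by apply: (line_closed nX (aA X) onY (nesym nY)); left; left.
  have onZX : line A X Z by apply: (line_closed nX aX onY XY); left; left.
  have uniq W : l W -> line A X W -> P = W.
    move=> onW hW; apply: on_unique => //.
    by rewrite -(lineE (nesym nX) (aA X) aP (nesym nP)).
  have eQ := uniq Q onQ onQX; have eZ := uniq Z onZ onZX.
  rewrite -eQ in hQ QY; rewrite -eZ in hZ.
  have [h|h] := between_nonbranching sp nP hP hQ.
    by apply: QY; apply: (between_meet btw h hQ); exact: bsym.
  by apply: PX; apply: (between_meet btw h hP).
have sYZ : same_side X Y Z by apply: (same_side_ray aX oY ZX); left.
have [_ oZ _] := sYZ.
have ZP : Z <> P by move=> e; apply: oZ; rewrite e.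
have ZQ : Z <> Q.
  move=> e; apply: oY; apply: (line_swap btw).
  apply: (line_closed nY (line_r btw A Y) _ (nesym ZY)); last first.
    by left; right; exact: bsym.
  by rewrite e; left; left.
have PQ : P <> Q.
  move=> e; apply: oY; apply: (line_closed nX (aA X) aP (nesym nP)).
  by rewrite e; left; right.
have oZY := not_opposite_same_side (aA X) (same_side_sym sYZ).
have [W hW hW'] := pray nX nP nY nZ (not_opposite_off (aA X) aX nX oY)
    (not_opposite_off' (aA X) aX nX oZ) oZY (or_introl hP)
    (ex_intro2 _ _ Z (ray_r btw _ _) hZ).
have [W2 hW2 hW2'] := pray nY nQ nP nZ (not_opposite_off' (aA X) aP nP oY)
    oZY (not_opposite_off' (aA X) aP nP oZ) (or_introl hQ)
    (ex_intro2 _ _ W hW (bsym hW')).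
have onW2 : l W2 by exact: (line_convex nBC onQ onP hW2').
have eW2 : Z = W2 by apply: on_unique => //; left.
rewrite -eW2 in hW2'.
exact: (no_quadrilateral hP PX hQ nQ oY (bsym hW2') ZP ZQ hZ ZX).
Qed.

(** The two previous lemmas only keep l off the segment; convexity follows, since a point of the
    other class would by [far_near_cross] bring a point of l onto it. *)
Lemma near_far_split : convex_split s (~` l) near far.
Proof.
have near_or_far X : ~ l X -> ~ near X -> far X.
  move=> lX nX; split=> //; apply: contrapT => h; apply: nX; split=> // Z hZ hZ'.
  by apply: h; exists Z.
split.
- apply/seteqP; split=> X; last by case=> -[].
  by move=> lX; have [h|h] := EM (near X); [left|right; exact: near_or_far].
- by apply/seteqP; split=> // X [[_ h1] [_ [Z hZ hZ']]]; exact: h1 hZ'.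
- split; first by exists A; split=> // Z /(between_id btw) ->.
  have onB : l B by exact: line_l.
  have [X [nX hX _]] := opposite_extend sp conn (nesym (on_neq onB)).
  exists X; split; last by exists B.
  move=> lX; apply: nX; apply/esym; apply: on_unique => //.
  by left; right.
split=> X Y hX hY Z hZ.
  have lZ := near_segment hX hY hZ.
  apply: contrapT => /(near_or_far Z lZ) fZ.
  have [W hW onW] := far_near_cross fZ hX.
  apply: (near_segment hX hY) onW; apply: (between_chain btw hZ); exact: bsym.
have lZ := far_segment hX hY hZ.
apply: near_or_far => // nZ; have [W hW onW] := far_near_cross hX nZ.
apply: (far_segment hX hY) onW; exact: between_chain hZ hW.
Qed.

End Separation.

(** * Verification of the plane axioms *)

Lemma line_splits B C : B <> C -> exists h1 h2,
  convex_split s (~` line B C) h1 h2 /\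
  forall X Y, h1 X -> h2 Y -> exists2 Z, s X Y Z & line B C Z.
Proof.
move=> nBC; have [lA|lA] := EM (line B C A).
  have [P hP nP] : exists2 P, line B C P & P <> A.
    have [e|nB] := EM (B = A); last by exists B => //; exact: line_l.
    by exists C; [exact: line_r|rewrite -e; exact: nesym].
  by rewrite (lineE nBC lA hP (nesym nP)); exact: separates.
exists (near B C), (far B C); split; first exact: near_far_split.
move=> X Y hX hY; have [Z hZ onZ] := far_near_cross nBC lA hY hX.
by exists Z => //; exact: bsym.
Qed.

(** The sides of a point P of the line are the ray PQ and the points opposite to it; [through_any]
    puts P between any point of one and any point of the other. *)
Lemma line_is_line B C : B <> C -> line_in s (line B C).
Proof.
move=> nBC; split; first exact: line_convex.
have mem X : line B C X -> exists x : line B C, set_val x = X.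
  by move=> h; exists (SigSub (mem_set h)).
have inj (x y : line B C) : set_val x = set_val y -> x = y by exact: val_inj.
have on (x : line B C) : line B C (set_val x) by exact: set_valP.
have [b eb] := mem B (line_l btw B C); have [c ec] := mem C (line_r btw B C).
split.
- exact: inherited_betweenness.
- exists b, c => e; apply: nBC.
  exact: etrans (esym eb) (etrans (congr1 set_val e) ec).
move=> p; set P := set_val p.
have [Q hQ nQ] : exists2 Q, line B C Q & Q <> P.
  have [e|nB] := EM (B = P); last by exists B => //; exact: line_l.
  by exists C; [exact: line_r|rewrite -e; exact: nesym].
have hPQ := lineE nBC (on p) hQ (nesym nQ).
have onPQ X : line B C X -> line P Q X by rewrite hPQ.
exists [set x | set_val x <> P /\ ray P Q (set_val x)].
exists [set x | set_val x <> P /\ opposite P Q (set_val x)].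
have excl X : X <> P -> ray P Q X -> opposite P Q X -> False.
  move=> nX h o; apply: (opposite_irrefl sp nQ).
  exact: (opposite_ray sp nQ nX nQ nQ (ray_r btw _ _) (ray_sym h) o).
split; first split.
- apply/seteqP; split=> x; last by case=> -[h _] e; apply: h; rewrite e.
  move=> nx; have nX : set_val x <> P by move=> /inj.
  by case: (line_opposite btw nQ nX (onPQ _ (on x))); [left|right].
- by apply/seteqP; split=> // x [[n h] [_ /(excl _ n h)]].
- split.
    by have [q eq] := mem Q hQ; exists q; split; rewrite eq //; exact: ray_r.
  have [R [nR hR o]] := opposite_extend sp conn nQ.
  have [|r er] := mem R; first by rewrite hPQ; right.
  by exists r; split; rewrite er.
- split=> x y [nx hx] [ny hy] z hz.
    have hz' : ray P Q (set_val z) := ray_convex sp nQ hx hy hz.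
    split=> // e; apply: (opposite_irrefl sp nQ).
    exists (set_val x), (set_val y); split=> //.
    by move: hz; rewrite /inherited /= e.
  have hxy : ray P (set_val x) (set_val y) := opposite_unique sp nQ nx ny hx hy.
  have hxz : ray P (set_val x) (set_val z).
    exact: (ray_convex sp nx (ray_r btw _ _) hxy hz).
  have nz : set_val z <> P.
    move=> e; apply: (opposite_irrefl sp nx); exists (set_val x), (set_val y).
    by split=> //; [exact: ray_r|move: hz; rewrite /inherited /= e].
  split=> //; exact: (opposite_ray sp nQ nx nQ nz (ray_r btw _ _) hxz hx).
move=> x y [nx hx] [ny hy]; apply: through_any => //.
exact: (opposite_ray sp nQ ny nx ny hx (ray_r btw _ _) hy).
Qed.

(** In a line through B and C, a point X on the same side of B as C shares with C a point Z across
    B. Both C and X are opposite to Z at B, so they are on one ray. *)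
Lemma line_largest B C : B <> C -> largest_line s B C (line B C).
Proof.
move=> nBC; split; first exact: line_is_line.
  by move=> X hX; left; left.
move=> m [_ lm] sub X mX; have mB := sub B (bl B C); have mC := sub C (br B C).
have [->|nX] := EM (X = B); first exact: line_l.
have [h|[Z [mZ nZ h1 h2]]] := line_separates lm mB mC mX (nesym nBC) nX.
  by right.
left; apply: (opposite_unique sp nZ (nesym nBC) nX).
  by apply: opposite_between => //; [exact: nesym|exact: bsym].
by apply: opposite_between => //; exact: bsym.
Qed.

End Lines.

Theorem theorem17p11 (T : Type) (s : T -> T -> set T)
    (s_pasch : pasch_space s)
    (s_conn : forall A B : T, connected_segment s (s A B))
    (bd_circle : exists A : T, is_circle (@boundary_betweenness T s A)) :
  is_plane s.
Proof.
case: bd_circle => A circ; have sp := s_pasch.1.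
have [h1 h2 h3 h4] := centre_lines s_pasch s_conn circ.
split=> //.
  have [_ [r _] _] := circ; have hr : boundary s A (set_val r) by exact: set_valP.
  by have [B nB _] := boundary_ray sp s_conn hr; exists A, B; exact: nesym.
have btw : is_betweenness s by case: sp.
move=> B C nBC; split=> //; exists (line s B C); split.
  exact: (line_largest s_pasch s_conn h1 h2 h3).
have [c1 [c2 [split12 cross]]] := line_splits s_pasch s_conn h1 h2 h3 h4 nBC.
exists c1, c2; split=> // X Y hX hY; have [Z hZ onZ] := cross X Y hX hY.
have lX : ~ line s B C X.
  case: split12 => e _ _ _; have : (c1 `|` c2) X by left.
  by rewrite -e.
(* A second common point W would span l together with Z, and X would be on it. *)
exists Z; apply/seteqP; split=> [W [hW onW]|W ->] //=.
apply: contrapT => nWZ; apply: lX.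
apply: (line_extend s_pasch s_conn h1 h2 h3 nBC onZ onW (nesym nWZ)).
have [k|k] := between_cases btw hZ hW.
  by left; right; exact: (between_sym btw k).
by right; apply: (between_sym btw); exact: (between_inner_r btw hZ k).
Qed.
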